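(* For each $n$, let $M=M^{(n)}\in\mathbb{R}^{n\times n}$ be real symmetric with spectral decomposition $M=\sum_{i=1}^n\lambda_iu_iu_i^T$, $\lambda_1>\cdots>\lambda_n$ distinct, $u_i$ orthonormal. Let $p\in(0,1)$ (possibly depending on $n$), let $Q$ be the random symmetric matrix with independent entries $Q_{ij}$ ($i\le j$) equal to $1/p$ with probability $p$ and $0$ otherwise, $S=M\circ Q$, $E=S-M$. Suppose there exist $\alpha=\alpha^{(n)}\in[0,1]^n$ and an absolute constant $\mu$ with $\sum_{i=1}^n|\lambda_i|n^{\alpha_i}\|u_i\|_\infty^2\le\mu$ and $\mathrm{Card}(u_i)\le n^{\alpha_i}$ for all $i,n$; let $\alpha_{\min}=\min_i\alpha_i$. Assume $p<1/2$, and that for some $\delta>0$, $\alpha_{\min}>(\log n)^{(\delta-3)/4}$ and $(\alpha_{\min}\log n)^4/(p\,n^{\alpha_{\min}})\to0$. Write $u=u_1$, let $\lambda_1(S)$ be the largest eigenvalue of $S$ and $v$ an associated eigenvector normalized so that $v^Tu=1$. Let $R=\sum_{j\ne1}\frac{1}{\lambda_j-\lambda_1}u_ju_j^T$ and $\Delta=R(E-(\lambda_1(S)-\lambda_1)\mathrm{Id})$. For $\varepsilon>0$ define $$\tilde v_\varepsilon=\begin{cases}v&\text{if }\|(\mathrm{Id}+\Delta)^{-1}\|_2\le1/\varepsilon,\\ u-REu+\Delta REu&\text{otherwise.}\end{cases}$$ Then for any $\eta>0$, for all $n$ large enough, $$\big\|\mathbb{E}[u-\tilde v_\varepsilon]\big\|_2\le\frac{8+\eta}{(\lambda_1-\lambda_2)^2}\frac{\mu^2}{p\,n^{\alpha_{\min}}}+\frac{16+\eta}{\varepsilon(\lambda_1-\lambda_2)^3}\Big(\frac{\mu^2}{p\,n^{\alpha_{\min}}}\Big)^{3/2}.$$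 If moreover $\frac{1}{\lambda_1-\lambda_2}\frac{\mu}{(p\,n^{\alpha_{\min}})^{1/2}}\to0$, then $v-\tilde v_\varepsilon=0$ with probability tending to one.
   Context: $\mathrm{Card}(x)$ is the number of nonzero entries of $x$; $\|x\|_\infty=\max_i|x_i|$; $\circ$ is the Hadamard product; $\|\cdot\|_2$ is the spectral (resp. Euclidean) norm.
   Formalization: The final claim (v equals ṽ_ε with probability tending to one) is proved for 0<ε<1 only; for ε≥1 it fails in general because the norm of (Id+Δ)^{-1} is always at least 1. The bias bound is proved for all ε>0. *)

(* Defs.v *)
From HB Require Import structures.
From mathcomp Require Import all_boot all_order all_algebra.
From mathcomp Require Import all_classical all_reals all_analysis.
Set Implicit Arguments. Unset Strict Implicit. Unset Printing Implicit Defensive.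
Import Order.TTheory GRing.Theory Num.Theory numFieldNormedType.Exports.
Local Open Scope classical_set_scope.
Local Open Scope ring_scope.

(* Dimension convention: the n-th matrix has dimension n.+2 (so that u_1, u_2
   exist); "n" of the paper is dimn n = (n.+2)%:R. *)
Definition dimn {R : realType} (n : nat) : R := (n.+2)%:R.

Section Defs.
Variable R : realType.

Definition enorm n (x : 'cV[R]_n) : R := Num.sqrt (\sum_i (x i 0) ^+ 2).
Definition infnorm n (x : 'cV[R]_n) : R := \big[Order.max/0]_i `|x i 0|.
Definition card_supp n (x : 'cV[R]_n) : nat := #|[set i | x i 0 != 0]|.
Definition opnorm m n (A : 'M[R]_(m, n)) : R :=
  sup [set enorm (A *m x) | x in [set x : 'cV[R]_n | enorm x = 1]].

Definition hadamard m n (A B : 'M[R]_(m, n)) : 'M[R]_(m, n) :=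
  \matrix_(i, j) (A i j * B i j).

Definition is_eigenvalue n (A : 'M[R]_n) (l : R) : Prop :=
  exists2 x : 'cV[R]_n, x != 0 & A *m x = l *: x.
Definition lam_max n (A : 'M[R]_n) : R :=
  xget 0 [set l | is_eigenvalue A l /\ forall l', is_eigenvalue A l' -> l' <= l].

Definition amin n (a : 'I_n.+1 -> R) : R := \big[Order.min/a ord0]_i a i.

(* Probability space of the random mask: an outcome w records for each pair
   (i,j) with i <= j whether Q_ij = 1/p (w (i,j) = true) or 0; entries below the
   diagonal of w are deterministically false (they are not used). *)
Definition omega n := {ffun 'I_n * 'I_n -> bool}.
Definition upper n (x : 'I_n * 'I_n) : bool := (x.1 <= x.2)%N.
Definition prob n (p : R) (w : omega n) : R :=
  (\prod_(x | upper x) (if w x then p else 1 - p)) *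
  (\prod_(x | ~~ upper x) (if w x then 0 else 1)).
Definition Qmat n (p : R) (w : omega n) : 'M[R]_n :=
  \matrix_(i, j) (if w (if (i <= j)%N then (i, j) else (j, i)) then p^-1 else 0).
Definition expect n m (p : R) (f : omega n -> 'cV[R]_m) : 'cV[R]_m :=
  \sum_w prob p w *: f w.
Definition Pr n (p : R) (P : omega n -> bool) : R := \sum_(w | P w) prob p w.

Section Perturbation.
Variables (n : nat) (M : 'M[R]_n.+1) (lam : 'I_n.+1 -> R) (U : 'M[R]_n.+1)
          (p : R) (eps : R).

Definition Smat (w : omega n.+1) := hadamard M (Qmat p w).
Definition Emat w := Smat w - M.
Definition uvec : 'cV[R]_n.+1 := col ord0 U.
Definition Rmat : 'M[R]_n.+1 :=
  \sum_(j | j != ord0) (lam j - lam ord0)^-1 *: (col j U *m (col j U)^T).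
Definition Delta w : 'M[R]_n.+1 :=
  Rmat *m (Emat w - (lam_max (Smat w) - lam ord0)%:M).
(* eigenvector of S for lambda_1(S), normalized by v^T u = 1 (chosen when it
   exists; it is unique whenever Id + Delta is invertible) *)
Definition vvec w : 'cV[R]_n.+1 :=
  xget uvec [set v | Smat w *m v = lam_max (Smat w) *: v /\ (v^T *m uvec) 0 0 = 1].
(* ||(Id + Delta)^{-1}||_2 <= 1/eps, with the convention that the norm of the
   inverse of a singular matrix is +oo *)
Definition good w : bool :=
  (1%:M + Delta w \in unitmx) && (opnorm (invmx (1%:M + Delta w)) <= eps^-1).
Definition vtilde w : 'cV[R]_n.+1 :=
  if good w then vvec w
  else uvec - Rmat *m Emat w *m uvec + Delta w *m Rmat *m Emat w *m uvec.
End Perturbation.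
End Defs.

(* Main.v *)
(* With |E x| <= e |x|, Weyl's inequality gives |Delta| <= 2 e / (lam_1 - lam_2), and
   v = (Id + Delta)^-1 u whenever Id + Delta is invertible, so that
     u - vtilde = R E u - Delta R E u + 1_good (Id + Delta)^-1 Delta^2 R E u,
   whose first term has mean zero. By Cauchy-Schwarz the other two are controlled
   by E e^4 and E |E u|^2 <= sigma^2, where sigma^2 = mu^2 / (p n^alpha_min); the
   constant 16 requires the sharp bound E e^4 <= ((2 + o(1)) sigma)^4.
   Since E = sum_k lam_k D_k (Q - 1) D_k with D_k = diag(u_k), Minkowski's
   inequality reduces it to E |X|^4 <= ((2 + o(1)) sqrt (N / p))^4 for the block X
   of Q - 1 on a set of at most N indices. The moments of Q - 1 are nonnegative
   because p < 1/2, so that T_l = E tr X^l is a sum of nonnegative terms over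
   closed walks. Removing the first edge of a walk together with its repetitions
   yields, up to errors of relative size l^2 / sqrt (p N),
     T_l <= (1/p) sum_(i + j = l - 2) T_i T_j,
   the recursion of the moments of the semicircle law, whose generating function
   is then bounded directly. *)
Require Import Defs.
From HB Require Import structures.
From mathcomp Require Import all_boot all_order all_algebra.
From mathcomp Require Import all_classical all_reals all_analysis.
From mathcomp Require Import ring lra zify.
Import Order.TTheory GRing.Theory Num.Theory numFieldNormedType.Exports.
Local Open Scope classical_set_scope.
Local Open Scope ring_scope.

(** No classification of closed walks by shape and no count of Catalan numbers is made: the constant
    [2] comes out as the inverse of the radius [1/2] up to which [F = 1 + z^2 F^2] has a real
    solution. The obstacle is that the recursion is not closed. When the first edge is traversed at
    least three times, the rest of the walk may be open, and the sum over its endpoints is not a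
    trace. Such sums are compared with traces outcome by outcome, by [1^T X^(2l) 1 <= N tr X^(2l)],
    and odd orders are interpolated between even ones. The bound on a block norm is the random
    variable [(tr X^L)^(1/L)] with [L] a power of two, so that Cauchy-Schwarz alone serves both to
    compare it with the norm and to average it. If [E e^4 <= (a sigma)^4] and [d] is the spectral
    gap, the bias is at most [2 a sigma^2 / d^2 + 4 a^2 sigma^3 / (eps d^3)]. The lower bound on
    [alpha_min] makes [alpha_min log n] diverge, so that moments of logarithmic order are available
    in every block. *)

(** * Convolution recursions and generating polynomials *)

Lemma even_or_odd l : exists k, l = k.*2 \/ l = k.*2.+1.
Proof. by exists l./2; have := odd_double_half l; case: odd; lia. Qed.

(** The left side keeps, among the nonnegative terms of the product, those whose two indices have
    sum less than [m]. *)
Lemma triangular_sum_le (R : realDomainType) (a b : nat -> R) m :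
  (forall i, 0 <= a i) -> (forall i, 0 <= b i) ->
  \sum_(L < m) \sum_(i < L.+1) a i * b (L - i)%N
  <= (\sum_(i < m) a i) * (\sum_(i < m) b i).
Proof.
move=> a0 b0.
have -> : \sum_(L < m) \sum_(i < L.+1) a i * b (L - i)%N
    = \sum_(L < m) \sum_(i < m | (i <= L)%N) a i * b (L - i)%N.
  apply: eq_bigr => L _.
  by rewrite (big_ord_widen_cond m xpredT (fun i => a i * b (L - i)%N)).
rewrite (exchange_big_dep xpredT) //= mulr_suml; apply: ler_sum => i _.
rewrite -mulr_sumr ler_wpM2l //.
have -> : \sum_(j < m | (i <= j)%N) b (j - i)%N = \sum_(j < m - i) b j.
  rewrite -(big_mkord (fun j => i <= j)%N (fun j => b (j - i)%N)).
  transitivity (\sum_(i <= j < m) b (j - i)%N).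
    by rewrite [RHS](big_nat_widenl i 0).
  rewrite -{1}[nat_of_ord i]add0n big_addn big_mkord.
  by apply: eq_bigr => j _; rewrite addnK.
rewrite (big_ord_widen m _ (leq_subr i m)) big_mkcond /=.
by apply: ler_sum => j _; case: ifP.
Qed.

Lemma sum_geometric_half_le (R : realFieldType) (z : R) m :
  0 <= z -> z <= 1 / 2 -> \sum_(i < m) z ^+ i <= 2.
Proof.
move=> z0 zh; have : (1 - z) * \sum_(i < m) z ^+ i = 1 - z ^+ m.
  elim: m => [|m IH]; first by rewrite big_ord0 mulr0 expr0 subrr.
  by rewrite big_ord_recr /= mulrDr IH exprS; ring.
have zm : 0 <= z ^+ m by exact: exprn_ge0.
have : 0 <= \sum_(i < m) z ^+ i by apply: sumr_ge0 => i _; exact: exprn_ge0.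
set s := \sum_(i < m) _; nra.
Qed.

(* The generating polynomial F satisfies F <= 1 + z^2 F^2 + k F, of which
   2/(1-k) is a fixed point when z = (1-k)/2. *)
Lemma convolution_rec_bound (R : realFieldType) (t : nat -> R) (k : R) n :
  (forall i, 0 <= t i) -> t 0%N <= 1 -> t 1%N = 0 -> 0 <= k -> k < 1 ->
  (forall L, (L.+2 <= n)%N ->
    t L.+2 <= \sum_(i < L.+1) t i * t (L - i)%N + k * \sum_(i < L.+1) t i) ->
  \sum_(i < n.+1) t i * ((1 - k) / 2) ^+ i <= 2 / (1 - k).
Proof.
move=> t0 t01 t10 k0 k1 rec; set z := (1 - k) / 2.
have z0 : 0 < z by rewrite /z; lra.
have zh : z <= 1 / 2 by rewrite /z; lra.
have k1' : 0 < 1 - k by lra.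
have B1 : 1 <= 2 / (1 - k) by rewrite ler_pdivlMr //; lra.
pose a i := t i * z ^+ i.
have a0 i : 0 <= a i by rewrite mulr_ge0 ?exprn_ge0 ?(ltW z0).
(* The coefficients up to index [m.+2] are controlled by the partial sum up to [m], whence a strong
   induction with two base cases. *)
suff main m : (m <= n)%N -> \sum_(i < m.+1) a i <= 2 / (1 - k) by exact: main.
elim/ltn_ind: m => -[_ _|[_ _|m IH mn]].
- by rewrite big_ord_recl big_ord0 addr0 /a mulr1; apply: le_trans B1.
- rewrite !big_ord_recl big_ord0 addr0 /a mulr1 /= t10 mul0r addr0.
  exact: le_trans B1.
rewrite 2!big_ord_recl /= {1}/a mulr1 /bump /= {1}/a t10 mul0r add0r.
set F := \sum_(i < m.+1) a i.
have F0 : 0 <= F by rewrite sumr_ge0.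
have FB : F <= 2 / (1 - k) by apply: IH; lia.
have step : \sum_(i < m.+1) a i.+2 <= z ^+ 2 * (F * F) + k * F.
  apply: (@le_trans _ _ (z ^+ 2 * \sum_(L < m.+1) \sum_(i < L.+1) a i * a (L - i)%N
     + k * z ^+ 2 * \sum_(L < m.+1) \sum_(i < L.+1) a i * z ^+ (L - i)%N)).
    rewrite !mulr_sumr -big_split /=; apply: ler_sum => L _.
    apply: (@le_trans _ _ ((\sum_(i < L.+1) t i * t (L - i)%N + k * \sum_(i < L.+1) t i) * z ^+ L.+2)).
      by rewrite /a ler_wpM2r ?exprn_ge0 ?(ltW z0) // rec //; have := ltn_ord L; lia.
    rewrite mulrDl -[k * _ * _]mulrA -[k * _ * _]mulrA lerD //.
      rewrite le_eqVlt; apply/orP; left; apply/eqP.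
      rewrite mulr_suml mulr_sumr; apply: eq_bigr => i _.
      have -> : z ^+ L.+2 = z ^+ (2 + (i + (L - i)))%N.
        by congr (_ ^+ _); have := ltn_ord i; lia.
      by rewrite /a 2!exprD; ring.
    rewrite le_eqVlt; apply/orP; left; apply/eqP; congr (_ * _).
    rewrite mulr_suml mulr_sumr; apply: eq_bigr => i _.
    have -> : z ^+ L.+2 = z ^+ (2 + (i + (L - i)))%N.
      by congr (_ ^+ _); have := ltn_ord i; lia.
    by rewrite /a 2!exprD; ring.
  apply: lerD.
    by rewrite ler_wpM2l ?exprn_ge0 ?(ltW z0) //; apply: triangular_sum_le.
  rewrite -mulrA ler_wpM2l //.
  have : \sum_(L < m.+1) \sum_(i < L.+1) a i * z ^+ (L - i)%N <= F * 2.
    apply: le_trans (triangular_sum_le _ _ (fun i => z ^+ i) _ a0 _) _.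
      by move=> i; rewrite exprn_ge0 ?(ltW z0).
    by rewrite ler_wpM2l // sum_geometric_half_le // ltW.
  (* The double sum is at most [2 * F] and [2 * z ^+ 2 <= 1], so the error term costs at most
     [k * F]. *)
  have z2 : z ^+ 2 <= 1 / 4 by nra.
  have : 0 <= \sum_(L < m.+1) \sum_(i < L.+1) a i * z ^+ (L - i)%N.
    by do 2!(apply: sumr_ge0 => ? _); rewrite mulr_ge0 ?exprn_ge0 ?(ltW z0).
  set Y := \sum_(L < m.+1) _; nra.
apply: (@le_trans _ _ (1 + (z ^+ 2 * (F * F) + k * F))).
  by apply: lerD.
have FF : F * F <= (2 / (1 - k)) ^+ 2 by nra.
have z20 : 0 <= z ^+ 2 by nra.
apply: (@le_trans _ _ (1 + (z ^+ 2 * (2 / (1 - k)) ^+ 2 + k * (2 / (1 - k))))).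
  by rewrite lerD2l lerD // ler_wpM2l.
rewrite le_eqVlt; apply/orP; left; apply/eqP; rewrite /z; field.
by rewrite lt0r_neq0.
Qed.

(** * Sums over walks *)

Section Walks.
Variables (R : realFieldType) (V E : finType) (ed : V -> V -> E) (S : {set V}).
Hypothesis edC : forall x y, ed x y = ed y x.
Hypothesis ed_inj : forall u v x y, ed u v = ed x y ->
  (u = x /\ v = y) \/ (u = y /\ v = x).

Implicit Types (F : seq E -> R) (G : seq E -> seq E -> R).

(* The sum of F over the edge sequences of the walks of length n from x to y
   whose later vertices lie in S. *)
Fixpoint walk_sum n x y F : R :=
  if n is m.+1 then \sum_(z in S) walk_sum m z y (fun s => F (ed x z :: s))
  else (x == y)%:R * F [::].

Lemma eq_walk_sum n x y F F' : F =1 F' -> walk_sum n x y F = walk_sum n x y F'.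
Proof.
elim: n x F F' => [|n IH] x F F' eF /=; first by rewrite eF.
by apply: eq_bigr => z _; apply: IH => s; rewrite eF.
Qed.

Lemma eq_walk_sum_in (P : pred E) n x y F F' :
  (forall u v, P (ed u v)) -> (forall s, all P s -> F s = F' s) ->
  walk_sum n x y F = walk_sum n x y F'.
Proof.
move=> Ped; elim: n x F F' => [|n IH] x F F' eF /=; first by rewrite eF.
by apply: eq_bigr => z _; apply: IH => s Ps; rewrite eF //= Ped.
Qed.

Lemma walk_sum_ge0 n x y F : (forall s, 0 <= F s) -> 0 <= walk_sum n x y F.
Proof.
elim: n x F => [|n IH] x F F0 /=; first by rewrite mulr_ge0 ?ler0n.
by apply: sumr_ge0 => z _; apply: IH => s.
Qed.

Lemma le_walk_sum n x y F F' :
  (forall s, F s <= F' s) -> walk_sum n x y F <= walk_sum n x y F'.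
Proof.
elim: n x F F' => [|n IH] x F F' le /=; first by rewrite ler_wpM2l ?ler0n.
by apply: ler_sum => z _; apply: IH => s.
Qed.

Lemma walk_sumD n x y F F' :
  walk_sum n x y (fun s => F s + F' s) = walk_sum n x y F + walk_sum n x y F'.
Proof.
elim: n x F F' => [|n IH] x F F' /=; first by rewrite mulrDr.
by rewrite -big_split /=; apply: eq_bigr => z _; rewrite IH.
Qed.

Lemma walk_sumZ n x y c F :
  walk_sum n x y (fun s => c * F s) = c * walk_sum n x y F.
Proof.
elim: n x F => [|n IH] x F /=; first by rewrite mulrCA.
by rewrite mulr_sumr; apply: eq_bigr => z _; rewrite IH.
Qed.

Lemma walk_sum_sum n x y (I : Type) (r : seq I) (P : pred I) (F : I -> seq E -> R) :
  walk_sum n x y (fun s => \sum_(i <- r | P i) F i s)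
  = \sum_(i <- r | P i) walk_sum n x y (F i).
Proof.
elim: n x F => [|n IH] x F /=; first by rewrite mulr_sumr.
by rewrite exchange_big /=; apply: eq_bigr => z _; rewrite IH.
Qed.

Lemma walk_sum_exchange n x y m a b G :
  walk_sum n x y (fun s => walk_sum m a b (G s))
  = walk_sum m a b (fun t => walk_sum n x y (fun s => G s t)).
Proof.
elim: n x G => [|n IH] x G /=; first by rewrite walk_sumZ.
by rewrite walk_sum_sum; apply: eq_bigr => z _; rewrite IH.
Qed.

Lemma walk_sum_cat n m x y F : x \in S ->
  walk_sum (n + m) x y F
  = \sum_(z in S) walk_sum n x z (fun s => walk_sum m z y (fun t => F (s ++ t))).
Proof.
elim: n x F => [|n IH] x F xS /=.
  rewrite (bigD1 x) //= eqxx mul1r big1 ?addr0 // => z /andP[_].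
  by rewrite eq_sym => /negbTE ->; rewrite mul0r.
rewrite exchange_big /=; apply: eq_bigr => z zS.
by rewrite IH.
Qed.

Lemma walk_sum_rcons n x y F : x \in S -> y \in S ->
  walk_sum n.+1 x y F
  = \sum_(z in S) walk_sum n x z (fun s => F (rcons s (ed z y))).
Proof.
move=> xS yS; rewrite -addn1 walk_sum_cat //; apply: eq_bigr => z zS.
apply: eq_walk_sum => s /=.
rewrite (bigD1 y) //= eqxx mul1r cats1 big1 ?addr0 // => w /andP[_].
by move=> /negbTE ->; rewrite mul0r.
Qed.

Lemma walk_sum_rev n x y F : x \in S -> y \in S ->
  walk_sum n x y F = walk_sum n y x (fun s => F (rev s)).
Proof.
elim: n x F => [|n IH] x F xS yS; first by rewrite /= eq_sym.
rewrite [RHS]walk_sum_rcons //=; apply: eq_bigr => z zS.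
by rewrite IH //; apply: eq_walk_sum => s; rewrite rev_rcons edC.
Qed.

Lemma walk_sum_cat_ge n m x y z F : x \in S -> z \in S -> (forall s, 0 <= F s) ->
  walk_sum n x z (fun s => walk_sum m z y (fun t => F (s ++ t)))
  <= walk_sum (n + m) x y F.
Proof.
move=> xS zS F0; rewrite walk_sum_cat // (bigD1 z) //= lerDl.
by apply: sumr_ge0 => w _; do 2!apply: walk_sum_ge0 => ?.
Qed.

Lemma walk_sumS_ge n x y z F : z \in S -> (forall s, 0 <= F s) ->
  walk_sum n z y (fun s => F (ed x z :: s)) <= walk_sum n.+1 x y F.
Proof.
move=> zS F0 /=; rewrite (bigD1 z) //= lerDl.
by apply: sumr_ge0 => w _; apply: walk_sum_ge0 => ?.
Qed.

(* The sum of G a b over the decompositions s = a ++ e :: b. *)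
Fixpoint split_sum e G s : R :=
  if s is a :: s' then (a == e)%:R * G [::] s' + split_sum e (fun t => G (a :: t)) s'
  else 0.

Lemma eq_split_sum e G G' s :
  (forall a b, s = a ++ e :: b -> G a b = G' a b) ->
  split_sum e G s = split_sum e G' s.
Proof.
elim: s G G' => [//|x s IH] G G' eG /=; congr (_ + _).
  by case: eqP => [xe|_]; rewrite ?mul0r // eG //= xe.
by apply: IH => a b sE; apply: eG; rewrite sE.
Qed.

Lemma split_sum_ge0 e G s : (forall a b, 0 <= G a b) -> 0 <= split_sum e G s.
Proof.
elim: s G => [//|x s IH] G G0 /=; apply: addr_ge0; last exact: IH.
by rewrite mulr_ge0 ?ler0n.
Qed.

Lemma split_sum_ge e G a b : (forall a b, 0 <= G a b) ->
  G a b <= split_sum e G (a ++ e :: b).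
Proof.
elim: a G => [|x a IH] G G0 /=.
  by rewrite eqxx mul1r lerDl split_sum_ge0.
by rewrite (le_trans (IH (fun t => G (x :: t)) _)) // lerDr mulr_ge0 ?ler0n.
Qed.

Lemma split_sum_sum e (I : Type) (r : seq I) (P : pred I) (K : I -> seq E -> seq E -> R) s :
  \sum_(i <- r | P i) split_sum e (K i) s = split_sum e (fun a b => \sum_(i <- r | P i) K i a b) s.
Proof.
elim: s K => [|x s IH] K /=; first by rewrite big1.
by rewrite big_split /= IH mulr_sumr.
Qed.

Lemma walk_sum_split_sum n x y e (K : seq E -> seq E -> seq E -> R) s :
  walk_sum n x y (fun t => split_sum e (fun a b => K a b t) s)
  = split_sum e (fun a b => walk_sum n x y (K a b)) s.
Proof.
elim: s K => [|z s IH] K /=.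
  by rewrite (eq_walk_sum _ _ _ _ (fun=> 0 * 0)) ?walk_sumZ ?mul0r // => t; rewrite mul0r.
by rewrite walk_sumD walk_sumZ IH.
Qed.

(** The removed step has position [i] in the walk and goes from [u] to [v]; what precedes and
    follows it are two independent walks. *)
Lemma walk_sum_split n x y e G : x \in S ->
  walk_sum n x y (split_sum e G)
  = \sum_(i < n) \sum_(u in S) \sum_(v in S) (ed u v == e)%:R *
      walk_sum i x u (fun s => walk_sum (n.-1 - i) v y (G s)).
Proof.
elim: n x G => [|n IH] x G xS; first by rewrite big_ord0 /= mulr0.
rewrite big_ord_recl /=.
under eq_bigr do rewrite walk_sumD walk_sumZ.
rewrite big_split /=; congr (_ + _).
  rewrite [RHS](bigD1 x) //= [X in _ = _ + X]big1 ?addr0.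
    by apply: eq_bigr => z zS; rewrite eqxx mul1r subn0.
  move=> u /andP[_ ux]; apply: big1 => v _.
  by rewrite [x == u]eq_sym (negbTE ux) mul0r mulr0.
under eq_bigr => z zS do rewrite IH //.
rewrite exchange_big /=; apply: eq_bigr => i _.
rewrite exchange_big /=; apply: eq_bigr => u _.
rewrite exchange_big /=; apply: eq_bigr => v _.
rewrite mulr_sumr; apply: eq_bigr => z zS.
by congr (_ * _); apply: eq_walk_sum => s; congr walk_sum; rewrite /bump; lia.
Qed.

(** An edge can be traversed in two directions only. For [x = y] they coincide and the right side
    counts the term twice. *)
Lemma sum_edge_le x y (H : V -> V -> R) : x \in S -> y \in S ->
  (forall u v, u \in S -> v \in S -> 0 <= H u v) ->
  \sum_(u in S) \sum_(v in S) (ed u v == ed x y)%:R * H u v <= H x y + H y x.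
Proof.
move=> xS yS H0.
have pick a b : a \in S -> b \in S ->
    H a b = \sum_(u in S) \sum_(v in S) ((u == a) && (v == b))%:R * H u v.
  move=> aS bS; rewrite (bigD1 a) //= (bigD1 b) //= !eqxx mul1r.
  rewrite !big1 ?addr0 // => [u /andP[_ /negbTE ->]|v /andP[_ /negbTE ->]].
    by rewrite big1 // => v _; rewrite mul0r.
  by rewrite mul0r.
rewrite (pick x y) // (pick y x) // -big_split /=.
apply: ler_sum => u uS; rewrite -big_split /=; apply: ler_sum => v vS.
rewrite -mulrDl ler_wpM2r ?H0 //.
case: eqP => [/ed_inj[[-> ->]|[-> ->]]|_]; rewrite ?eqxx /=.
- by rewrite lerDl ler0n.
- by rewrite lerDr ler0n.
- by rewrite addr_ge0 ?ler0n.
Qed.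

Lemma walk_sum_split_le n a b x y G : a \in S -> x \in S -> y \in S ->
  (forall s t, 0 <= G s t) ->
  walk_sum n a b (split_sum (ed x y) G)
  <= \sum_(i < n) (walk_sum i a x (fun s => walk_sum (n.-1 - i) y b (G s))
                 + walk_sum i a y (fun s => walk_sum (n.-1 - i) x b (G s))).
Proof.
move=> aS xS yS G0; rewrite walk_sum_split //; apply: ler_sum => i _.
apply: (sum_edge_le x y
  (fun u v => walk_sum i a u (fun s => walk_sum (n.-1 - i) v b (G s)))) => //.
by move=> u v _ _; do 2!apply: walk_sum_ge0 => ?.
Qed.

(** * Deleting two traversals of an edge *)

Definition perm_invariant F := forall s t, perm_eq s t -> F s = F t.

(** Each pair of occurrences of [e] is counted once, in the order of the list, so that [k]
    occurrences contribute ['C(k, 2)] terms. *)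
Definition split2_sum e F :=
  split_sum e (fun s1 s2 => split_sum e (fun t1 t2 => F (s1 ++ t1 ++ t2)) s2).

Section PermInvariant.
Variable F : seq E -> R.
Hypothesis FP : perm_invariant F.
Hypothesis F0 : forall s, 0 <= F s.

(** Three pieces with unrelated endpoints, evaluated jointly. Permutation invariance of [F] allows
    them to be reordered and reversed until consecutive endpoints match. *)
Let walk3 i j k x1 y1 x2 y2 x3 y3 :=
  walk_sum i x1 y1 (fun s1 => walk_sum j x2 y2 (fun s2 =>
    walk_sum k x3 y3 (fun s3 => F (s1 ++ s2 ++ s3)))).

Lemma walk3_le i j k a b c d : a \in S -> b \in S -> c \in S ->
  walk3 i j k a b b c c d <= walk_sum (i + (j + k)) a d F.
Proof.
move=> aS bS cS.
apply: le_trans (walk_sum_cat_ge i (j + k) a d b F aS bS F0).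
by apply: le_walk_sum => s1; apply: (walk_sum_cat_ge j k b d c (fun t => F (s1 ++ t))).
Qed.

Lemma walk3_swap12 i j k a b c d e f : walk3 i j k a b c d e f = walk3 j i k c d a b e f.
Proof.
rewrite /walk3 walk_sum_exchange; do 3!apply: eq_walk_sum => ?.
by apply: FP; rewrite perm_catCA.
Qed.

Lemma walk3_swap23 i j k a b c d e f : walk3 i j k a b c d e f = walk3 i k j a b e f c d.
Proof.
rewrite /walk3; apply: eq_walk_sum => s1.
rewrite walk_sum_exchange; do 2!apply: eq_walk_sum => ?.
by apply: FP; rewrite perm_cat2l perm_catC.
Qed.

Lemma walk3_rev2 i j k a b c d e f : c \in S -> d \in S ->
  walk3 i j k a b c d e f = walk3 i j k a b d c e f.
Proof.
move=> cS dS; rewrite /walk3; apply: eq_walk_sum => s1.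
rewrite walk_sum_rev //; do 2!apply: eq_walk_sum => ?.
by apply: FP; rewrite perm_cat2l perm_cat2r perm_rev.
Qed.

(* Two traversals of the edge xy cut a walk from y to x into three pieces; in
   each of the four cases the pieces recombine into a walk from y to x. *)
Lemma walk_sum_split2_le n x y : x \in S -> y \in S ->
  walk_sum n y x (split2_sum (ed x y) F)
  <= (4 * n ^ 2)%:R * walk_sum n.-2 y x F.
Proof.
move=> xS yS; set W := walk_sum n.-2 y x F.
have W0 : 0 <= W by exact: walk_sum_ge0.
rewrite /split2_sum; apply: le_trans (walk_sum_split_le _ _ _ _ _ _ _ _ _ _) _ => //.
  by move=> s t; apply: split_sum_ge0.
have -> : (4 * n ^ 2)%:R * W = \sum_(i < n) (4 * n)%:R * W.
  by rewrite sumr_const card_ord -[RHS]mulr_natl mulrA -natrM; congr (_%:R * _); lia.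
apply: ler_sum => i _.
set j := (n.-1 - i)%N.
have -> : (4 * n)%:R * W = \sum_(k < n) 4%:R * W.
  by rewrite sumr_const card_ord -[RHS]mulr_natl mulrA -natrM mulnC.
have half z z' : y \in S -> z' \in S ->
    (forall k l, (i + (k + l) = n.-2)%N ->
       walk3 i k l y z z' x y x <= W /\ walk3 i k l y z z' y x x <= W) ->
    walk_sum i y z (fun s => walk_sum j z' x (split_sum (ed x y)
      (fun t1 t2 => F (s ++ t1 ++ t2)))) <= \sum_(k < n) 2 * W.
  move=> zS z'S HW.
  have jn : (j <= n)%N by rewrite /j; lia.
  have -> : \sum_(k < n) 2 * W = n%:R * (2 * W) by rewrite sumr_const card_ord [RHS]mulr_natl.
  have : j%:R * (2 * W) <= n%:R * (2 * W) by rewrite ler_wpM2r ?ler_nat ?mulr_ge0.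
  apply: le_trans.
  have -> : j%:R * (2 * W) = \sum_(k < j) 2 * W by rewrite sumr_const card_ord [LHS]mulr_natl.
  have : walk_sum i y z (fun s => walk_sum j z' x (split_sum (ed x y)
      (fun t1 t2 => F (s ++ t1 ++ t2)))) <=
    walk_sum i y z (fun s => \sum_(k < j) (walk_sum k z' x (fun t1 => walk_sum (j.-1 - k) y x
          (fun t2 => F (s ++ t1 ++ t2))) + walk_sum k z' y (fun t1 => walk_sum (j.-1 - k) x x
          (fun t2 => F (s ++ t1 ++ t2))))).
    by apply: le_walk_sum => s; apply: walk_sum_split_le.
  move=> /le_trans; apply; rewrite walk_sum_sum; apply: ler_sum => k _.
  rewrite walk_sumD.
  have nE : (i + (k + (j.-1 - k)) = n.-2)%N.
    by have := ltn_ord i; have := ltn_ord k; rewrite /j; lia.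
  have [H1 H2] := HW _ _ nE.
  by rewrite mulr_natl mulr2n; apply: lerD.
have -> : \sum_(k < n) 4 * W = \sum_(k < n) 2 * W + \sum_(k < n) 2 * W.
  by rewrite -big_split /=; apply: eq_bigr => k _; ring.
apply: lerD; apply: half => // k l nE; split; rewrite /W -nE.
(* The endpoints of the three pieces are, in the four cases, [yx yx yx], [yx yy xx], [yy xx yx] and
   [yy xy xx]. *)
- by rewrite walk3_rev2 //; apply: walk3_le.
- by rewrite walk3_swap12 addnCA; apply: walk3_le.
- by rewrite walk3_swap23 [(k + l)%N]addnC; apply: walk3_le.
- by rewrite walk3_rev2 //; apply: walk3_le.
Qed.

End PermInvariant.

(** * Trace recursion for an abstract moment functional *)

(** Rotating a closed walk so that it starts with the removed step only permutes its edges, so the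
    [n] possible positions contribute equally. *)
Lemma closed_walk_split n e F : perm_invariant F ->
  \sum_(x in S) walk_sum n x x (split_sum e (fun a b => F (a ++ b)))
  = n%:R * \sum_(u in S) \sum_(v in S) (ed u v == e)%:R * walk_sum n.-1 v u F.
Proof.
move=> FP; under eq_bigr => x xS do rewrite walk_sum_split //.
rewrite exchange_big /=.
transitivity (\sum_(i < n) \sum_(u in S) \sum_(v in S)
    (ed u v == e)%:R * walk_sum n.-1 v u F); last first.
  by rewrite sumr_const card_ord mulr_natl.
apply: eq_bigr => i _.
rewrite exchange_big /=; apply: eq_bigr => u uS.
rewrite exchange_big /=; apply: eq_bigr => v vS.
rewrite -mulr_sumr; congr (_ * _).
have -> : n.-1 = ((n.-1 - i) + i)%N by have := ltn_ord i; lia.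
rewrite walk_sum_cat //; apply: eq_bigr => x xS.
rewrite walk_sum_exchange addnK; do 2!apply: eq_walk_sum => ?.
by apply: FP; rewrite perm_catC.
Qed.

(** [mom s] abstracts the joint moment of the centered entries listed by [s], and [q] stands for
    [1/p]. The hypotheses are nonnegativity, symmetry, independence of disjoint lists, and a bound
    on the effect of one more occurrence of an edge. *)
Variables (mom : seq E -> R) (q : R).
Hypothesis mom_ge0 : forall s, 0 <= mom s.
Hypothesis mom_perm : perm_invariant mom.
Hypothesis mom_disjoint : forall s t, ~~ has [in s] t -> mom (s ++ t) = mom s * mom t.
Hypothesis q_ge0 : 0 <= q.
Hypothesis mom_cons : forall e s,
  mom (e :: s) <= q * split_sum e (fun a b => mom (a ++ b)) s
    + q ^+ 2 * split2_sum e mom s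
    + q ^+ 2 * split2_sum e (fun t => mom (e :: t)) s.

(** For the moments of the mask, these two quantities are the expectations of [tr X^n] and of the
    sum [1^T X^n 1] of all entries of [X^n]. *)
Definition trace_mom n := \sum_(x in S) walk_sum n x x mom.
Definition entries_mom n := \sum_(x in S) \sum_(y in S) walk_sum n x y mom.

Lemma trace_mom_ge0 n : 0 <= trace_mom n.
Proof. by apply: sumr_ge0 => x _; apply: walk_sum_ge0. Qed.

(** Lists without a common edge are independent. If [e] is common to both, extracting it from each
    of them is one of the terms of the last sum, and equals the left side up to a permutation. *)
Lemma mom_cat_le s t : mom (s ++ t) <= mom s * mom t +
  \sum_e split_sum e (fun a b => split_sum e (fun c d =>
      mom (e :: (a ++ b) ++ e :: c ++ d)) t) s.
Proof.
set X := \sum_e _.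
have X0 : 0 <= X.
  by apply: sumr_ge0 => e _; do 2!apply: split_sum_ge0 => ? ?.
have [|/mom_disjoint ->] := boolP (has [in s] t); last by rewrite lerDl.
move=> /hasP[e et es]; rewrite -[leLHS]add0r; apply: lerD; first exact: mulr_ge0.
rewrite /X (bigD1 e) //=; set Y := split_sum _ _ _.
suff : mom (s ++ t) <= Y.
  move=> /le_trans; apply; rewrite lerDl; apply: sumr_ge0 => ? _.
  by do 2!apply: split_sum_ge0 => ? ?.
rewrite {}/Y; case/splitPr: et => c d; case/splitPr: es => a b.
apply: le_trans (split_sum_ge _ _ _ _ _); last first.
  by move=> ? ?; apply: split_sum_ge0.
apply: le_trans (split_sum_ge _ _ _ _ _) => //.
rewrite (mom_perm _ (e :: (a ++ b) ++ e :: c ++ d)) //.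
rewrite -cat_cons; apply: perm_cat.
  by rewrite perm_catC /= perm_cons perm_catC.
by rewrite perm_catC /= perm_cons perm_catC.
Qed.

(* Two closed walks sharing an edge merge into a closed walk through it. *)
Lemma two_traces_le i j :
  \sum_(x in S) \sum_(y in S) walk_sum i x x (fun s => walk_sum j y y (fun t => mom (s ++ t)))
  <= trace_mom i * trace_mom j + (2 * i * j)%:R * trace_mom (i + j).
Proof.
pose H e s t := mom (e :: s ++ e :: t).
have HP1 e s : perm_invariant (H e s).
  by move=> t t' tt'; apply: mom_perm; rewrite perm_cons perm_cat2l perm_cons.
have HP2 e t : perm_invariant (H e ^~ t).
  by move=> s s' ss'; apply: mom_perm; rewrite perm_cons perm_cat2r.
have -> : trace_mom i * trace_mom j = \sum_(x in S) \sum_(y in S)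
    walk_sum i x x (fun s => walk_sum j y y (fun t => mom s * mom t)).
  rewrite mulr_suml; apply: eq_bigr => x _; rewrite mulr_sumr; apply: eq_bigr => y _.
  rewrite mulrC -walk_sumZ; apply: eq_walk_sum => s.
  by rewrite walk_sumZ mulrC.
pose J e s := \sum_(y in S) walk_sum j y y (split_sum e (fun c d => H e s (c ++ d))).
have JE e s : J e s = j%:R * \sum_(u in S) \sum_(v in S)
    (ed u v == e)%:R * walk_sum j.-1 v u (H e s) by exact: closed_walk_split.
have JP e : perm_invariant (J e).
  move=> s s' ss'; apply: eq_bigr => y _; apply: eq_walk_sum => t.
  by apply: eq_split_sum => a b _; apply: HP2.
set B := \sum_(x in S) \sum_(y in S) _; set A := \sum_(x in S) \sum_(y in S) _.
have : B <= A + \sum_e \sum_(x in S) walk_sum i x x (split_sum e (fun a b => J e (a ++ b))).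
  rewrite [X in _ <= _ + X]exchange_big /= /A /B -big_split /=; apply: ler_sum => x _.
  apply: (@le_trans _ _ (walk_sum i x x (fun s => \sum_(y in S) walk_sum j y y (fun t => mom s * mom t)
     + \sum_e split_sum e (fun a b => J e (a ++ b)) s))); last first.
    by rewrite walk_sumD !walk_sum_sum.
  rewrite -walk_sum_sum; apply: le_walk_sum => s.
  have -> : \sum_e split_sum e (fun a b => J e (a ++ b)) s
    = \sum_(y in S) walk_sum j y y (fun t => \sum_e split_sum e (fun a b =>
        split_sum e (fun c d => H e (a ++ b) (c ++ d)) t) s).
    under [RHS]eq_bigr do rewrite walk_sum_sum; rewrite exchange_big /=.
    apply: eq_bigr => e _; rewrite -split_sum_sum; apply: eq_bigr => y _.
    by rewrite walk_sum_split_sum.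
  rewrite -big_split /=; apply: ler_sum => y _.
  by rewrite -walk_sumD; apply: le_walk_sum => t; apply: mom_cat_le.
move=> /le_trans; apply; rewrite lerD2l.
under eq_bigr do rewrite closed_walk_split //.
rewrite -mulr_sumr.
have [->|i0] := posnP i; first by rewrite mul0r mulr_ge0 ?trace_mom_ge0.
have [j0|j0] := posnP j.
  rewrite [X in _ * X]big1 ?mulr0 ?mulr_ge0 ?trace_mom_ge0 // => e _.
  do 2!(apply: big1 => ? _); rewrite (eq_walk_sum _ _ _ _ (fun=> 0 * 0)).
    by rewrite walk_sumZ mul0r mulr0.
  by move=> s; rewrite JE j0 !mul0r.
have -> : (2 * i * j)%:R * trace_mom (i + j)
    = i%:R * (j%:R * (trace_mom (i + j) + trace_mom (i + j))) by rewrite !natrM; ring.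
rewrite ler_wpM2l //.
pose W u v u' v' := walk_sum i.-1 v u (fun s => walk_sum j.-1 v' u' (H (ed u v) s)).
have W0 u v u' v' : 0 <= W u v u' v'.
  by apply: walk_sum_ge0 => s; apply: walk_sum_ge0 => t; apply: mom_ge0.
have -> : \sum_e \sum_(u in S) \sum_(v in S) (ed u v == e)%:R * walk_sum i.-1 v u (J e)
    = j%:R * \sum_(u in S) \sum_(v in S) \sum_(u' in S) \sum_(v' in S)
       (ed u' v' == ed u v)%:R * W u v u' v'.
  rewrite exchange_big mulr_sumr /=; apply: eq_bigr => u _.
  rewrite exchange_big mulr_sumr /=; apply: eq_bigr => v _.
  rewrite (bigD1 (ed u v)) //= eqxx mul1r [X in _ + X]big1 ?addr0; last first.
    by move=> e; rewrite eq_sym => /negbTE ->; rewrite mul0r.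
  rewrite (eq_walk_sum _ _ _ _ _ (JE _)) walk_sumZ walk_sum_sum; congr (_ * _).
  apply: eq_bigr => u' _; rewrite walk_sum_sum; apply: eq_bigr => v' _.
  by rewrite walk_sumZ.
rewrite ler_wpM2l //.
(* Both walks being cut at the shared edge, the edge [uv], a walk from [v] to [u], the edge [uv]
   again and a second walk from [v] to [u] make up a closed walk of length [i + j]. *)
have merge : \sum_(u in S) \sum_(v in S) W u v u v <= trace_mom (i + j).
  apply: ler_sum => u uS.
  have -> : (i + j = (i.-1 + j).+1)%N by lia.
  apply: ler_sum => v vS.
  apply: le_trans (walk_sum_cat_ge i.-1 j v u u (fun s => mom (ed u v :: s)) vS uS _) => //.
  apply: le_walk_sum => s; rewrite -[X in _ <= walk_sum X _ _ _](prednK j0).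
  exact: (walk_sumS_ge j.-1 u u v (fun t => mom (ed u v :: s ++ t))).
(* If the two walks cross the shared edge in opposite directions, reversing the second one leads
   back to the previous case. *)
have flip u v : u \in S -> v \in S -> W u v v u = W u v u v.
  move=> uS vS; apply: eq_walk_sum => s; rewrite walk_sum_rev //.
  by apply: eq_walk_sum => t; apply: HP1; rewrite perm_rev.
apply: (@le_trans _ _ (\sum_(u in S) \sum_(v in S) (W u v u v + W u v v u))).
  apply: ler_sum => u uS; apply: ler_sum => v vS.
  exact: (sum_edge_le u v (W u v)).
under eq_bigr do rewrite big_split; rewrite big_split /=; apply: lerD => //.
apply: le_trans merge; apply: ler_sum => u uS; apply: ler_sum => v vS.
by rewrite flip.
Qed.

Lemma trace_mom0 : mom [::] = 1 -> trace_mom 0 = #|S|%:R.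
Proof.
move=> m1; rewrite /trace_mom /= -sum1_card natr_sum.
by apply: eq_bigr => x _; rewrite eqxx m1 mul1r.
Qed.

Lemma trace_mom1 : (forall e, mom [:: e] = 0) -> trace_mom 1 = 0.
Proof.
move=> m0; rewrite /trace_mom /= big1 // => x _; apply: big1 => y _.
by rewrite m0 mulr0.
Qed.

(* Expand in the first edge: a single further traversal of it gives the
   Wigner-type convolution, and two further traversals are of lower order. *)
Lemma trace_mom_rec L :
  trace_mom L.+2 <= q * \sum_(i < L.+1) trace_mom i * trace_mom (L - i)
    + (q * (L.+1 + 2 * L.+1 ^ 3)%:R + q ^+ 2 * (4 * L.+1 ^ 2)%:R) * trace_mom L
    + q ^+ 2 * (4 * L.+1 ^ 2)%:R * (if L is L'.+1 then entries_mom L' else 0).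
Proof.
have q20 : 0 <= q ^+ 2 by rewrite exprn_ge0.
have split_ge0 e s F : (forall t, 0 <= F t) -> 0 <= split2_sum e F s.
  by move=> F0; do 2!apply: split_sum_ge0 => ? ?.
have split1 e a F : split2_sum e F [:: a] = 0.
  by rewrite /split2_sum /= mulr0 addr0.
(* A second traversal opposite to the first leaves two closed walks, hence the convolution. One in
   the same direction leaves two walks from [y] to [x]; reversing one of them gives a single closed
   walk of length [L]. *)
have H1 : \sum_(x in S) \sum_(y in S) walk_sum L.+1 y x (split_sum (ed x y) (fun a b => mom (a ++ b)))
  <= \sum_(i < L.+1) trace_mom i * trace_mom (L - i) + (L.+1 + 2 * L.+1 ^ 3)%:R * trace_mom L.
  apply: (@le_trans _ _ (\sum_(i < L.+1) (trace_mom L + (trace_mom i * trace_mom (L - i)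
      + (2 * i * (L - i))%:R * trace_mom L)))); last first.
    rewrite !big_split /= sumr_const card_ord -[trace_mom L *+ _]mulr_natl natrD mulrDl addrCA lerD2l lerD2l.
    have -> : (2 * L.+1 ^ 3)%:R * trace_mom L = \sum_(i < L.+1) (2 * L.+1 ^ 2)%:R * trace_mom L.
      by rewrite sumr_const card_ord -[RHS]mulr_natl mulrA -natrM; congr (_%:R * _); lia.
    apply: ler_sum => i _; rewrite ler_wpM2r ?trace_mom_ge0 // ler_nat.
    by have := ltn_ord i; nia.
  apply: (@le_trans _ _ (\sum_(x in S) \sum_(y in S) \sum_(i < L.+1)
     (walk_sum i y x (fun s => walk_sum (L - i) y x (fun t => mom (s ++ t)))
      + walk_sum i y y (fun s => walk_sum (L - i) x x (fun t => mom (s ++ t)))))).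
    by apply: ler_sum => x xS; apply: ler_sum => y yS; apply: walk_sum_split_le.
  under eq_bigr do rewrite exchange_big; rewrite exchange_big /=.
  apply: ler_sum => i _; under eq_bigr do rewrite big_split; rewrite big_split /=.
  have iL : (i + (L - i) = L)%N by have := ltn_ord i; lia.
  apply: lerD; last first.
    by rewrite exchange_big /=; have := two_traces_le i (L - i); rewrite iL.
  have -> : trace_mom L = trace_mom (i + (L - i)) by rewrite iL.
  rewrite exchange_big /=; apply: ler_sum => y yS.
  rewrite walk_sum_cat //; apply: ler_sum => x xS; apply: le_walk_sum => s.
  rewrite walk_sum_rev //; apply: le_walk_sum => t.
  by rewrite (mom_perm _ (s ++ t)) // perm_cat2l perm_rev.
(* With all three traversals removed, an open walk from [y] to [x] with [L - 1] steps remains,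
   summed over both endpoints. For [L = 0] there is no room for two further traversals. *)
have H2 : \sum_(x in S) \sum_(y in S) walk_sum L.+1 y x (split2_sum (ed x y) mom)
  <= (4 * L.+1 ^ 2)%:R * (if L is L'.+1 then entries_mom L' else 0).
  case: L {H1} => [|L].
    rewrite mulr0 big1 // => x _; apply: big1 => y _; apply: big1 => z _.
    by rewrite /= split1 mulr0.
  rewrite mulr_sumr exchange_big; apply: ler_sum => y yS.
  rewrite mulr_sumr; apply: ler_sum => x xS; exact: walk_sum_split2_le.
(* Here the first edge is retained and closes the remaining walk, so that a trace of order [L]
   reappears. *)
have H3 : \sum_(x in S) \sum_(y in S) walk_sum L.+1 y x
     (split2_sum (ed x y) (fun t => mom (ed x y :: t)))
  <= (4 * L.+1 ^ 2)%:R * trace_mom L.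
  case: L {H1 H2} => [|L].
    rewrite big1 ?mulr_ge0 ?trace_mom_ge0 // => x _; apply: big1 => y _; apply: big1 => z _.
    by rewrite /= split1 mulr0.
  rewrite mulr_sumr; apply: ler_sum => x xS.
  rewrite mulr_sumr; apply: ler_sum => y yS; apply: walk_sum_split2_le => // s t st.
  by apply: mom_perm; rewrite perm_cons.
have -> : trace_mom L.+2 = \sum_(x in S) \sum_(y in S) walk_sum L.+1 y x (fun s => mom (ed x y :: s)) by [].
apply: (@le_trans _ _ (\sum_(x in S) \sum_(y in S) walk_sum L.+1 y x (fun s =>
   q * split_sum (ed x y) (fun a b => mom (a ++ b)) s
    + q ^+ 2 * split2_sum (ed x y) mom s
    + q ^+ 2 * split2_sum (ed x y) (fun t => mom (ed x y :: t)) s))).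
  by do 2!(apply: ler_sum => ? _); apply: le_walk_sum => s; apply: mom_cons.
under eq_bigr do under eq_bigr do rewrite !walk_sumD !walk_sumZ.
under eq_bigr do rewrite !big_split -!mulr_sumr.
rewrite !big_split -!mulr_sumr.
move: (ler_wpM2l q_ge0 H1) (ler_wpM2l q20 H2) (ler_wpM2l q20 H3).
set a := _ + _; set b := \sum_(x in S) _; set c := \sum_(x in S) _; set d := \sum_(x in S) _.
rewrite /a mulrDr => h1 h2 h3.
apply: le_trans (lerD (lerD h1 h2) h3) _.
by rewrite le_eqVlt; apply/orP; left; apply/eqP; ring.
Qed.


(** Divided by [N * rho ^+ l], the traces satisfy the recursion of [convolution_rec_bound] with
    error [11 * D], where [D = n^2 q / rho]. Here [11 = 3 + 4 + 4]: a single further traversal, then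
    the two kinds of double traversals. The conclusion retains one coefficient of the generating
    polynomial. *)
Lemma trace_mom_bound (N rho : R) n :
  mom [::] = 1 -> (forall e, mom [:: e] = 0) ->
  1 <= q -> 0 < N -> 0 < rho -> rho ^+ 2 = N * q -> #|S|%:R <= N ->
  (forall l, entries_mom l.*2 <= N * trace_mom l.*2) ->
  (forall l, entries_mom l.*2.+1
     <= N / 2 * (rho * trace_mom l.*2 + rho^-1 * trace_mom l.*2.+2)) ->
  11 * (n%:R ^+ 2 * q / rho) < 1 ->
  trace_mom n <= N * rho ^+ n * (2 / (1 - 11 * (n%:R ^+ 2 * q / rho))) ^+ n.+1.
Proof.
move=> m1 m0 q1 N0 r0 r2 SN Geven Godd; set D := n%:R ^+ 2 * q / rho => D1.
have D0 : 0 <= D by rewrite /D !mulr_ge0 // ?invr_ge0 ltW.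
have Dr : n%:R ^+ 2 * q = D * rho by rewrite /D divfK ?lt0r_neq0.
clearbody D.
pose t l := trace_mom l / (N * rho ^+ l).
have tE l : trace_mom l = t l * (N * rho ^+ l).
  by rewrite divfK // mulf_neq0 ?expf_neq0 ?lt0r_neq0.
have t0 l : 0 <= t l by rewrite divr_ge0 ?trace_mom_ge0 // mulr_ge0 ?exprn_ge0 ?(ltW r0) ?(ltW N0).
have tsum L (i : 'I_L.+1) : t i <= \sum_(j < L.+1) t j.
  by rewrite (bigD1 i) //= lerDl sumr_ge0.
have rec L : (L.+2 <= n)%N ->
    t L.+2 <= \sum_(i < L.+1) t i * t (L - i)%N + 11 * D * \sum_(i < L.+1) t i.
  move=> Ln; set s := \sum_(j < _) t j.
  rewrite /t ler_pdivrMr; last by rewrite mulr_gt0 // exprn_gt0.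
  apply: le_trans (trace_mom_rec L) _.
  have -> : q * \sum_(i < L.+1) trace_mom i * trace_mom (L - i)
      = (\sum_(i < L.+1) t i * t (L - i)%N) * (N * rho ^+ L.+2).
    rewrite mulr_sumr mulr_suml; apply: eq_bigr => i _.
    have -> : rho ^+ L.+2 = rho ^+ (2 + (i + (L - i)))%N.
      by congr (_ ^+ _); have := ltn_ord i; lia.
    by rewrite !tE 2!exprD r2; ring.
  rewrite [X in _ <= X]mulrDl -addrA lerD2l.
  have L1n : L.+1%:R <= n%:R :> R by rewrite ler_nat; lia.
  have L11 : 1 <= L.+1%:R :> R by rewrite ler1n.
  have LD : L.+1%:R ^+ 2 * q <= D * rho.
    by rewrite -Dr ler_wpM2r // lerXn2r ?nnegrE ?(le_trans _ L11).
  have Dle : D ^+ 2 <= D by nra.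
  have c1 : q * (L.+1 + 2 * L.+1 ^ 3)%:R + q ^+ 2 * (4 * L.+1 ^ 2)%:R <= 7 * D * rho ^+ 2.
    rewrite natrD (natrM _ 2) (natrM _ 4) !natrX.
    have h1 : q * (L.+1%:R + 2 * L.+1%:R ^+ 3) <= 3 * (L.+1%:R ^+ 2 * q) ^+ 2.
      have -> : 3 * (L.+1%:R ^+ 2 * q) ^+ 2
        = q * (q * (3 * L.+1%:R ^+ 4)) :> R by ring.
      rewrite ler_wpM2l //; apply: (@le_trans _ _ (3 * L.+1%:R ^+ 4)).
        have := ler_wpM2l (le_trans ler01 L11) L11 => a1.
        have p3 : L.+1%:R <= L.+1%:R ^+ 3 :> R by rewrite ler_eXnr.
        have p4 : L.+1%:R ^+ 3 <= L.+1%:R ^+ 4 :> R by rewrite ler_weXn2l.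
        by lra.
      by rewrite ler_peMl // mulr_ge0 ?exprn_ge0 ?(le_trans _ L11).
    have h2 : q ^+ 2 * (4 * L.+1%:R ^+ 2) <= 4 * (L.+1%:R ^+ 2 * q) ^+ 2.
      have -> : q ^+ 2 * (4 * L.+1%:R ^+ 2) = 4 * (L.+1%:R ^+ 2 * q ^+ 2) :> R by ring.
      rewrite ler_wpM2l // exprMn -exprM ler_wpM2r ?exprn_ge0 // ler_weXn2l //.
    have h3 : (L.+1%:R ^+ 2 * q) ^+ 2 <= D * rho ^+ 2.
      apply: (@le_trans _ _ ((D * rho) ^+ 2)).
        have x0 : 0 <= L.+1%:R ^+ 2 * q by rewrite mulr_ge0 ?exprn_ge0.
        by rewrite lerXn2r ?nnegrE // (le_trans x0 LD).
      by rewrite exprMn ler_wpM2r ?exprn_ge0 // ltW.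
    by lra.
  have T1 : (q * (L.+1 + 2 * L.+1 ^ 3)%:R + q ^+ 2 * (4 * L.+1 ^ 2)%:R) * trace_mom L
      <= 7 * D * s * (N * rho ^+ L.+2).
    apply: (@le_trans _ _ (7 * D * rho ^+ 2 * trace_mom L)).
      by rewrite ler_wpM2r ?trace_mom_ge0.
    rewrite tE -[L.+2]add2n exprD.
    have -> : 7 * D * s * (N * (rho ^+ 2 * rho ^+ L)) = 7 * D * rho ^+ 2 * (s * (N * rho ^+ L)) by ring.
    apply: ler_wpM2l; first by rewrite !mulr_ge0 ?exprn_ge0 ?(ltW r0).
    apply: ler_wpM2r; first by rewrite !mulr_ge0 ?exprn_ge0 ?(ltW r0) ?(ltW N0).
    exact: (tsum L (@Ordinal L.+1 L (ltnSn L))).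
  have cG : q ^+ 2 * (4 * L.+1 ^ 2)%:R * N <= 4 * D * rho ^+ 3.
    have -> : q ^+ 2 * (4 * L.+1 ^ 2)%:R * N = 4 * (L.+1%:R ^+ 2 * q) * (N * q).
      by rewrite (natrM _ 4) natrX; ring.
    have -> : 4 * D * rho ^+ 3 = 4 * (D * rho) * (N * q) by rewrite -r2; ring.
    apply: ler_wpM2r; first by rewrite mulr_ge0 ?(ltW N0).
    exact: ler_wpM2l.
  have T2 : q ^+ 2 * (4 * L.+1 ^ 2)%:R * (if L is L'.+1 then entries_mom L' else 0)
      <= 4 * D * s * (N * rho ^+ L.+2).
    case: L Ln @s {T1 c1 L1n L11 LD} cG => [|L] Ln s cG.
      by rewrite mulr0 !mulr_ge0 ?sumr_ge0 ?exprn_ge0 ?(ltW r0) ?(ltW N0).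
    have s0 : 0 <= s by rewrite sumr_ge0.
    have ts i : (i < L.+2)%N -> t i <= s by move=> iL; exact: (tsum L.+1 (Ordinal iL)).
    clearbody s.
    have G_le : entries_mom L <= N * (s * (N * rho ^+ L)).
      have [k LE] := even_or_odd L.
      case: LE => LE; rewrite LE in ts *.
        apply: le_trans (Geven k) _; rewrite tE; apply: ler_wpM2l; first exact: ltW.
        apply: ler_wpM2r; first by rewrite mulr_ge0 ?exprn_ge0 ?(ltW r0) ?(ltW N0).
        exact: ts (leqW (leqnn _)).
      (* For odd [L] the order [L.+1] intervenes, which is the last index covered by [s]. *)
      apply: le_trans (Godd k) _; rewrite -mulrA; apply: ler_wpM2l; first exact: ltW.
      rewrite !tE; set x := t k.*2; set y := t k.*2.+2.
      have -> : rho * (x * (N * rho ^+ k.*2)) + rho^-1 * (y * (N * rho ^+ k.*2.+2))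
          = (x + y) * (N * rho ^+ k.*2.+1).
        by rewrite [rho ^+ k.*2.+2]exprS [rho ^+ k.*2.+1]exprS; field; rewrite gt_eqF.
      rewrite mulrA; apply: ler_wpM2r; first by rewrite mulr_ge0 ?exprn_ge0 ?(ltW r0) ?(ltW N0).
      have xs : x <= s by exact: ts (leqW (leqW (leqnn _))).
      have ys : y <= s by exact: ts (leqnn _).
      by lra.
    apply: (@le_trans _ _ (q ^+ 2 * (4 * L.+2 ^ 2)%:R * (N * (s * (N * rho ^+ L))))).
      by rewrite ler_wpM2l // mulr_ge0 ?exprn_ge0.
    have -> : 4 * D * s * (N * rho ^+ L.+3) = (4 * D * rho ^+ 3) * (s * (N * rho ^+ L)).
      by rewrite -[L.+3]add3n exprD; ring.
    rewrite mulrA; apply: ler_wpM2r => //; first by rewrite !mulr_ge0 ?exprn_ge0 ?(ltW r0) ?(ltW N0).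
  have -> : 11 * D * s * (N * rho ^+ L.+2)
     = 7 * D * s * (N * rho ^+ L.+2) + 4 * D * s * (N * rho ^+ L.+2) by ring.
  exact: lerD.
have t00 : t 0%N <= 1.
  by rewrite /t trace_mom0 // expr0 mulr1 ler_pdivrMr // mul1r.
have t10 : t 1%N = 0 by rewrite /t trace_mom1 // mul0r.
have D11 : 0 <= 11 * D by lra.
have := convolution_rec_bound R t (11 * D) n t0 t00 t10 D11 D1 rec.
set z := (1 - 11 * D) / 2; have z0 : 0 < z by rewrite /z; lra.
have zE : 2 / (1 - 11 * D) = z^-1 by rewrite /z invf_div.
rewrite zE big_ord_recr /= => gen.
have {}gen : t n * z ^+ n <= z^-1.
  apply: le_trans gen; rewrite lerDr; apply: sumr_ge0 => i _.
  by rewrite mulr_ge0 ?exprn_ge0 // ltW.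
rewrite tE.
have -> : N * rho ^+ n * z^-1 ^+ n.+1 = z^-1 * z^-1 ^+ n * (N * rho ^+ n) by rewrite exprS; ring.
apply: ler_wpM2r.
  by rewrite mulr_ge0 ?exprn_ge0 ?(ltW r0) ?(ltW N0).
by rewrite exprVn ler_pdivlMr ?exprn_gt0.
Qed.

End Walks.

(** * Moments of the random mask *)

(** Lagrange's identity: twice the difference of the two sides is a weighted double sum of
    squares. *)
Lemma sum_Cauchy_Schwarz (R : realFieldType) (I : finType) (P : pred I) (w a b : I -> R) :
  (forall i, 0 <= w i) ->
  (\sum_(i | P i) w i * (a i * b i)) ^+ 2
  <= (\sum_(i | P i) w i * a i ^+ 2) * (\sum_(i | P i) w i * b i ^+ 2).
Proof.
move=> w0.
have : 0 <= \sum_(i | P i) \sum_(j | P j) w i * w j * (a i * b j - a j * b i) ^+ 2.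
  by do 2!(apply: sumr_ge0 => ? _); rewrite mulr_ge0 ?sqr_ge0 ?mulr_ge0.
have -> : \sum_(i | P i) \sum_(j | P j) w i * w j * (a i * b j - a j * b i) ^+ 2
  = \sum_(i | P i) \sum_(j | P j) (w i * a i ^+ 2) * (w j * b j ^+ 2)
   + \sum_(i | P i) \sum_(j | P j) (w i * b i ^+ 2) * (w j * a j ^+ 2)
   - 2 * \sum_(i | P i) \sum_(j | P j) (w i * (a i * b i)) * (w j * (a j * b j)).
  rewrite mulr_sumr -sumrN -!big_split /=; apply: eq_bigr => i _.
  rewrite mulr_sumr -sumrN -!big_split /=; apply: eq_bigr => j _.
  by ring.
have prod (f g : I -> R) : \sum_(i | P i) \sum_(j | P j) f i * g j
    = (\sum_(i | P i) f i) * (\sum_(j | P j) g j).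
  by rewrite mulr_suml; apply: eq_bigr => i _; rewrite mulr_sumr.
rewrite !prod expr2; set x := \sum_(i | P i) _; set y := \sum_(i | P i) _.
by set z := \sum_(i | P i) _; lra.
Qed.

Section Mask.
Variables (R : realType) (n : nat) (p : R).
Hypothesis p_gt0 : 0 < p.
Hypothesis p_lt : p < 1 / 2.

Let q := p^-1.

Let q_gt2 : 2 < q.
Proof. by rewrite /q -(ltr_pM2r p_gt0) mulVf ?gt_eqF //; move: p_lt; lra. Qed.

Let p_lt1 : p < 1.
Proof. by move: p_lt; lra. Qed.

Let pq : p * q = 1.
Proof. by rewrite /q mulfV ?gt_eqF. Qed.

Definition edge (i j : 'I_n) : 'I_n * 'I_n := if (i <= j)%N then (i, j) else (j, i).

Lemma edgeC i j : edge i j = edge j i.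
Proof.
rewrite /edge; case: (leqP i j) => [ij|/ltnW ->] //; case: leqP => // ji.
by have -> : i = j by apply: val_inj => /=; lia.
Qed.

Lemma edge_inj u v x y : edge u v = edge x y -> (u = x /\ v = y) \/ (u = y /\ v = x).
Proof. by rewrite /edge; do 2!case: leqP => _; case=> -> ->; [left|right|right|left]. Qed.

Lemma edge_upper i j : upper (edge i j).
Proof. by rewrite /edge /upper; case: (leqP i j) => //= /ltnW. Qed.

Definition xi (w : omega n) e : R := (if w e then p^-1 else 0) - 1.

Definition mask_mean (f : omega n -> R) : R := \sum_w prob p w * f w.

Lemma prob_ge0 (w : omega n) : 0 <= prob p w.
Proof.
apply: mulr_ge0; apply: prodr_ge0 => x _; case: ifP => _ //; first exact: ltW.
by rewrite subr_ge0 ltW.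
Qed.

Lemma mask_mean_ge0 f : (forall w, 0 <= f w) -> 0 <= mask_mean f.
Proof. by move=> f0; apply: sumr_ge0 => w _; rewrite mulr_ge0 ?prob_ge0. Qed.

Lemma le_mask_mean f g : (forall w, f w <= g w) -> mask_mean f <= mask_mean g.
Proof. by move=> fg; apply: ler_sum => w _; rewrite ler_wpM2l ?prob_ge0. Qed.

Lemma eq_mask_mean f g : f =1 g -> mask_mean f = mask_mean g.
Proof. by move=> fg; apply: eq_bigr => w _; rewrite fg. Qed.

Lemma mask_meanD f g : mask_mean (fun w => f w + g w) = mask_mean f + mask_mean g.
Proof. by rewrite -big_split; apply: eq_bigr => w _; rewrite mulrDr. Qed.

Lemma mask_meanZ c f : mask_mean (fun w => c * f w) = c * mask_mean f.
Proof. by rewrite mulr_sumr; apply: eq_bigr => w _; rewrite mulrCA. Qed.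

Lemma mask_mean_sum (I : Type) (r : seq I) (P : pred I) (f : I -> omega n -> R) :
  mask_mean (fun w => \sum_(i <- r | P i) f i w) = \sum_(i <- r | P i) mask_mean (f i).
Proof. by rewrite exchange_big; apply: eq_bigr => w _; rewrite mulr_sumr. Qed.

Lemma mask_mean_Cauchy_Schwarz f g :
  mask_mean (fun w => f w * g w) ^+ 2
  <= mask_mean (fun w => f w ^+ 2) * mask_mean (fun w => g w ^+ 2).
Proof. by apply: sum_Cauchy_Schwarz => w; apply: prob_ge0. Qed.

Definition centered_mom k : R := p * (p^-1 - 1) ^+ k + (1 - p) * (-1) ^+ k.

Definition mask_mom (s : seq ('I_n * 'I_n)) : R := \prod_e centered_mom (count_mem e s).

(** Independence: the sum over outcomes factors over coordinates, [g] being the weight of a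
    coordinate times its power in the product. Coordinates below the diagonal are constant and do
    not have the moments [centered_mom], whence the condition on [s]. *)
Lemma mask_mean_prod s : all (@upper n) s ->
  mask_mean (fun w => \prod_(e <- s) xi w e) = mask_mom s.
Proof.
move=> us.
pose g (x : 'I_n * 'I_n) (b : bool) : R :=
  (if upper x then if b then p else 1 - p else if b then 0 else 1)
  * ((if b then p^-1 else 0) - 1) ^+ count_mem x s.
transitivity (\prod_x \sum_b g x b).
  rewrite bigA_distr_bigA /=; apply: eq_bigr => w _.
  rewrite /g big_split /=; congr (_ * _).
    rewrite /prob [RHS](bigID (@upper n)) /=; congr (_ * _).
      by apply: eq_bigr => x ->.
    by apply: eq_bigr => x /negbTE ->.
  transitivity (\prod_x xi w x ^+ count_mem x s); last by [].
  elim: s {us g} => [|e s IH] /=; first by rewrite big_nil big1.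
  rewrite big_cons IH [RHS](bigD1 e) //= [X in _ * X](bigD1 e) //= eqxx exprS -mulrA.
  by do 2!congr (_ * _); apply: eq_bigr => x /negbTE; rewrite eq_sym => ->.
apply: eq_bigr => x _; rewrite big_bool /g /centered_mom; case: (boolP (upper x)) => [//|ux].
  by rewrite sub0r.
have -> : count_mem x s = 0%N.
  by apply/count_memPn; apply: contra ux => /(allP us).
by rewrite !expr0 !mulr1 addrC subrK /= add0r.
Qed.

Lemma centered_mom0 : centered_mom 0 = 1.
Proof. by rewrite /centered_mom !expr0; ring. Qed.

Lemma centered_mom1 : centered_mom 1 = 0.
Proof. by rewrite /centered_mom !expr1; move: pq; rewrite /q; lra. Qed.

Lemma centered_mom2 : centered_mom 2 = p^-1 - 1.
Proof.
have pq2 : p * q ^+ 2 = q by rewrite expr2 mulrA pq mul1r.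
by rewrite /centered_mom -/q; move: pq pq2; lra.
Qed.

(** Since [p (q - 1) = 1 - p], the moment of order [k + 1] is [(1 - p) ((q - 1)^k - (-1)^k)], and
    [p < 1/2] gives [q - 1 >= 1]. *)
Lemma centered_mom_ge0 k : 0 <= centered_mom k.
Proof.
have h : p * (q - 1) = 1 - p by rewrite mulrBr pq mulr1.
case: k => [|k]; first by rewrite centered_mom0.
rewrite /centered_mom -/q !exprS [p * _]mulrA h mulN1r.
have h1 : 1 <= (q - 1) ^+ k by rewrite exprn_ege1 //; move: q_gt2; lra.
have : `|(-1) ^+ k| <= 1 :> R by rewrite normrX normrN1 expr1n.
rewrite ler_norml => /andP[_ h2].
by rewrite -mulrDr mulr_ge0 //; [move: p_lt1; lra|lra].
Qed.

Lemma centered_mom3_le : centered_mom 3 <= p^-1 ^+ 2.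
Proof.
have pq2 : p * q ^+ 2 = q by rewrite expr2 mulrA pq mul1r.
have pq3 : p * q ^+ 3 = q ^+ 2 by rewrite exprS mulrA pq mul1r.
by rewrite /centered_mom -/q; move: q_gt2 pq pq2 pq3; lra.
Qed.

(** Up to the alternating signs the ratio of the two moments is [(q - 1)^2]; the excess of [q^2]
    over it absorbs the signs because [q > 2]. *)
Lemma centered_momD2_le k : centered_mom k.+4 <= p^-1 ^+ 2 * centered_mom k.+2.
Proof.
rewrite /centered_mom -/q.
have h : p * (q - 1) = 1 - p by rewrite mulrBr pq mulr1.
have h1 : 1 <= (q - 1) ^+ k by rewrite exprn_ege1 //; move: q_gt2; lra.
have h2 : (-1) ^+ k = 1 :> R \/ (-1) ^+ k = -1 :> R.
  by rewrite -signr_odd; case: odd; [right|left].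
have -> : p * (q - 1) ^+ k.+4 = (1 - p) * ((q - 1) ^+ k * (q - 1) ^+ 3).
  by rewrite -h -exprD addn3 exprS; ring.
have -> : p * (q - 1) ^+ k.+2 = (1 - p) * ((q - 1) ^+ k * (q - 1)).
  by rewrite -h 2!exprS; ring.
have -> : (-1) ^+ k.+4 = (-1) ^+ k :> R by rewrite -addn4 exprD; ring.
have -> : (-1) ^+ k.+2 = (-1) ^+ k :> R by rewrite -addn2 exprD; ring.
have -> : (q ^+ 2 * ((1 - p) * ((q - 1) ^+ k * (q - 1)) + (1 - p) * (-1) ^+ k))
  = (1 - p) * (q ^+ 2 * ((q - 1) ^+ k * (q - 1) + (-1) ^+ k)) by ring.
rewrite -mulrDr ler_wpM2l //; first by rewrite subr_ge0 ltW.
move: q_gt2; set y := (q - 1) ^+ k in h1 * => q2; case: h2 => ->.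
  have : 0 <= y * (q - 1) * (2 * q - 1) + (q ^+ 2 - 1).
    by rewrite addr_ge0 ?mulr_ge0 //; nra.
  by nra.
have : 0 <= (y - 1) * ((q - 1) * (2 * q - 1)) by rewrite !mulr_ge0 //; lra.
by nra.
Qed.

Lemma mask_mom_ge0 s : 0 <= mask_mom s.
Proof. by apply: prodr_ge0 => e _; apply: centered_mom_ge0. Qed.

Lemma mask_mom_perm : @perm_invariant R _ mask_mom.
Proof. by move=> s t /permP st; apply: eq_bigr => e _; rewrite st. Qed.

Lemma mask_mom_nil : mask_mom [::] = 1.
Proof. by rewrite /mask_mom big1 // => e _; apply: centered_mom0. Qed.

Lemma mask_mom_seq1 e : mask_mom [:: e] = 0.
Proof. by rewrite /mask_mom (bigD1 e) //= eqxx centered_mom1 mul0r. Qed.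

Lemma mask_mom_disjoint s t :
  ~~ has [in s] t -> mask_mom (s ++ t) = mask_mom s * mask_mom t.
Proof.
move=> /hasPn st; rewrite -big_split; apply: eq_bigr => e _ /=.
rewrite count_cat; have [et|/count_memPn ->] := boolP (e \in t).
  by have /count_memPn -> := st _ et; rewrite centered_mom0 mul1r.
by rewrite addn0 centered_mom0 mulr1.
Qed.

Lemma split_sum_const (E : finType) (e : E) (c : R) s :
  split_sum R E e (fun _ _ => c) s = (count_mem e s)%:R * c.
Proof. by elim: s => [|a s IH] /=; rewrite ?mul0r // IH natrD mulrDl. Qed.

Lemma split_sum_count (E : finType) (e : E) (c : R) s :
  split_sum R E e (fun _ b => (count_mem e b)%:R * c) s = ('C(count_mem e s, 2))%:R * c.
Proof.
elim: s => [|a s IH] /=; first by rewrite mul0r.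
rewrite IH; case: eqP => _; rewrite ?mul1r ?mul0r ?add0r //= add1n binS bin1 natrD; ring.
Qed.

(* If e occurs k times in s, this is the inequality
   m (k+1) <= q k m (k-1) + q^2 C(k,2) m (k-2) + q^2 C(k,2) m (k-1)
   between the moments m of Q - 1: the three terms cover k = 1, k = 2, k >= 3. *)
Lemma mask_mom_cons e s :
  mask_mom (e :: s) <= p^-1 * split_sum R _ e (fun a b => mask_mom (a ++ b)) s
    + p^-1 ^+ 2 * split2_sum R _ e mask_mom s
    + p^-1 ^+ 2 * split2_sum R _ e (fun t => mask_mom (e :: t)) s.
Proof.
pose rest t := \prod_(x | x != e) centered_mom (count_mem x t).
have momE t : mask_mom t = centered_mom (count_mem e t) * rest t.
  by rewrite /mask_mom (bigD1 e).
have rest_cons t : rest (e :: t) = rest t.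
  by apply: eq_bigr => x /negbTE /=; rewrite eq_sym => ->.
have rest_del a b : rest (a ++ e :: b) = rest (a ++ b).
  by apply: eq_bigr => x /negbTE xe; rewrite !count_cat /= eq_sym xe.
have rest0 t : 0 <= rest t by apply: prodr_ge0 => x _; apply: centered_mom_ge0.
set k := count_mem e s.
have -> : split_sum R _ e (fun a b => mask_mom (a ++ b)) s
    = k%:R * (centered_mom k.-1 * rest s).
  rewrite -split_sum_const; apply: eq_split_sum => a b sE.
  rewrite momE /k sE rest_del !count_cat /= eqxx; congr (centered_mom _ * _); lia.
have -> : split2_sum R _ e mask_mom s = ('C(k, 2))%:R * (centered_mom k.-2 * rest s).
  rewrite -split_sum_count; apply: eq_split_sum => a b sE.
  rewrite -split_sum_const; apply: eq_split_sum => c d bE.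
  have -> : rest s = rest (a ++ c ++ d) by rewrite sE bE rest_del !catA rest_del.
  rewrite momE /k sE bE !count_cat /= eqxx !count_cat /= eqxx.
  by congr (centered_mom _ * _); lia.
have -> : split2_sum R _ e (fun t => mask_mom (e :: t)) s
    = ('C(k, 2))%:R * (centered_mom k.-2.+1 * rest s).
  rewrite -split_sum_count; apply: eq_split_sum => a b sE.
  rewrite -split_sum_const; apply: eq_split_sum => c d bE.
  have -> : rest s = rest (a ++ c ++ d) by rewrite sE bE rest_del !catA rest_del.
  rewrite momE rest_cons /k sE bE /= eqxx !count_cat /= eqxx !count_cat /= eqxx.
  by congr (centered_mom _ * _); lia.
rewrite momE rest_cons /= eqxx add1n -/k !mulrA -!mulrDl ler_wpM2r //.
have q0 : 0 < q by move: q_gt2; lra.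
rewrite -/q; move: k => -[|[|[|k]]] /=.
- by rewrite centered_mom1 bin0n mulr0 !mul0r mulr0 mul0r !addr0.
- by rewrite centered_mom2 centered_mom0 bin_small // !mulr0 !mul0r -/q; lra.
- rewrite centered_mom1 centered_mom0 binn mulr0 !mulr1 mulr0 add0r addr0; exact: centered_mom3_le.
- have C1 : 1 <= ('C(k.+3, 2))%:R :> R by rewrite ler1n bin_gt0.
  apply: (@le_trans _ _ (q ^+ 2 * 'C(k.+3, 2)%:R * centered_mom k.+2)).
    apply: le_trans (centered_momD2_le k) _.
    rewrite ler_wpM2r ?centered_mom_ge0 // -/q.
    by rewrite ler_peMr // exprn_ge0 // ltW.
  by rewrite lerDr addr_ge0 // !mulr_ge0 ?centered_mom_ge0 ?exprn_ge0 ?(ltW q0).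
Qed.


(** * Powers of a block of the centered mask *)

Section MaskedBlock.
Variable S : {set 'I_n}.

Notation wsum := (walk_sum R 'I_n ('I_n * 'I_n)%type edge S).

(** For [x] and [y] in [S], the entry [(x, y)] of [X^l], where [X] is the block of [Q - 1] indexed
    by [S]. *)
Definition mask_walk l x y w := wsum l x y (fun s => \prod_(e <- s) xi w e).

Lemma mask_walk_cat l m x y w : x \in S ->
  mask_walk (l + m) x y w = \sum_(z in S) mask_walk l x z w * mask_walk m z y w.
Proof.
move=> xS; rewrite /mask_walk walk_sum_cat //; apply: eq_bigr => z _.
rewrite [RHS]mulrC -walk_sumZ; apply: eq_walk_sum => s.
rewrite [RHS]mulrC -walk_sumZ; apply: eq_walk_sum => t.
by rewrite big_cat.
Qed.

Lemma mask_walkC l x y w : x \in S -> y \in S -> mask_walk l x y w = mask_walk l y x w.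
Proof.
move=> xS yS; rewrite /mask_walk walk_sum_rev //; last exact: edgeC.
by apply: eq_walk_sum => s; apply: perm_big; rewrite perm_rev.
Qed.

Lemma mask_walk1 x y w : y \in S -> mask_walk 1 x y w = xi w (edge x y).
Proof.
move=> yS; rewrite /mask_walk /= (bigD1 y) //= eqxx mul1r big_seq1 big1 ?addr0 //.
by move=> z /andP[_ /negbTE ->]; rewrite mul0r.
Qed.

Lemma mask_mean_walk l x y :
  mask_mean (mask_walk l x y) = wsum l x y mask_mom.
Proof.
rewrite /mask_mean /mask_walk.
under eq_bigr do rewrite -walk_sumZ.
rewrite -walk_sum_sum; apply: (eq_walk_sum_in _ _ _ _ _ (@upper n)).
  exact: edge_upper.
by move=> s us; apply: mask_mean_prod.
Qed.

Definition walk_trace l w := \sum_(x in S) mask_walk l x x w.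
Definition walk_total l w := \sum_(x in S) \sum_(y in S) mask_walk l x y w.

Notation tmom := (trace_mom R 'I_n ('I_n * 'I_n)%type edge S mask_mom).
Notation emom := (entries_mom R 'I_n ('I_n * 'I_n)%type edge S mask_mom).

Lemma mask_mean_walk_trace l : mask_mean (walk_trace l) = tmom l.
Proof.
by rewrite mask_mean_sum; apply: eq_bigr => x _; rewrite mask_mean_walk.
Qed.

Lemma mask_mean_walk_total l : mask_mean (walk_total l) = emom l.
Proof.
rewrite mask_mean_sum; apply: eq_bigr => x _; rewrite mask_mean_sum.
by apply: eq_bigr => y _; rewrite mask_mean_walk.
Qed.

Lemma walk_trace_double l w :
  walk_trace l.*2 w = \sum_(x in S) \sum_(z in S) mask_walk l x z w ^+ 2.
Proof.
apply: eq_bigr => x xS; rewrite -addnn mask_walk_cat //; apply: eq_bigr => z zS.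
by rewrite [mask_walk l z x w]mask_walkC.
Qed.

Lemma walk_trace_double_ge0 l w : 0 <= walk_trace l.*2 w.
Proof. by rewrite walk_trace_double; do 2!apply: sumr_ge0 => ? _; rewrite sqr_ge0. Qed.

Let rowsum l z w := \sum_(x in S) mask_walk l z x w.

Lemma walk_totalD l m w :
  walk_total (l + m) w = \sum_(z in S) rowsum l z w * rowsum m z w.
Proof.
rewrite /walk_total.
under eq_bigr => x xS do under eq_bigr do rewrite mask_walk_cat //.
under eq_bigr do rewrite exchange_big /=.
rewrite exchange_big /=; apply: eq_bigr => z zS.
rewrite /rowsum mulr_suml; apply: eq_bigr => x xS.
by rewrite mulr_sumr; apply: eq_bigr => y yS; rewrite [mask_walk l x z w]mask_walkC.
Qed.

(** As [X] is symmetric, [1^T X^(2l) 1 = |X^l 1|^2], and Cauchy-Schwarz in each row bounds it by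
    [|S|] times the squared Frobenius norm of [X^l], which is [tr X^(2l)]. *)
Lemma walk_total_even_le l w : walk_total l.*2 w <= #|S|%:R * walk_trace l.*2 w.
Proof.
rewrite -{1}addnn walk_totalD walk_trace_double mulr_sumr; apply: ler_sum => z _.
have := sum_Cauchy_Schwarz R 'I_n (mem S) (fun=> 1) (fun=> 1) (fun x => mask_walk l z x w)
   (fun=> ler01).
under eq_bigr do rewrite !mul1r.
under [X in _ <= X * _]eq_bigr do rewrite expr1n mulr1.
under [X in _ <= _ * X]eq_bigr do rewrite mul1r.
by rewrite sumr_const -expr2.
Qed.

(** The odd sum is the scalar product of [X^l 1] and [X^(l+1) 1]. The weights [rho] and [rho^-1] of
    the arithmetic-geometric inequality balance the two terms when [X] has norm of order [rho]. *)
Lemma walk_total_odd_le l rho w : 0 < rho ->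
  walk_total l.*2.+1 w
  <= (rho * walk_total l.*2 w + rho^-1 * walk_total l.*2.+2 w) / 2.
Proof.
move=> r0; have -> : l.*2.+2 = (l.+1 + l.+1)%N by lia.
have -> : l.*2.+1 = (l + l.+1)%N by lia.
rewrite -addnn !walk_totalD !mulr_sumr -big_split mulr_suml; apply: ler_sum => z _ /=.
set a := rowsum l z w; set b := rowsum l.+1 z w.
have -> : (rho * (a * a) + rho^-1 * (b * b)) / 2 = a * b + rho^-1 / 2 * (rho * a - b) ^+ 2.
  by field; rewrite gt_eqF.
by rewrite lerDl mulr_ge0 ?sqr_ge0 // divr_ge0 // invr_ge0 ltW.
Qed.

Section VectorNorm.
Variables (v : 'I_n -> R) (w : omega n).

Let sqv := \sum_(x in S) v x ^+ 2.
(** This is [|X^l v|^2]. *)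
Let iter_norm l := \sum_(x in S) (\sum_(y in S) mask_walk l x y w * v y) ^+ 2.

Let iter_norm_ge0 l : 0 <= iter_norm l.
Proof. by apply: sumr_ge0 => x _; rewrite sqr_ge0. Qed.

Let sqv_ge0 : 0 <= sqv.
Proof. by apply: sumr_ge0 => x _; rewrite sqr_ge0. Qed.

Let iter_norm_double l : iter_norm l ^+ 2 <= sqv * iter_norm l.*2.
Proof.
have -> : iter_norm l = \sum_(x in S) 1 * (v x * \sum_(y in S) mask_walk l.*2 x y w * v y).
  rewrite /iter_norm.
  transitivity (\sum_(z in S) \sum_(x in S) \sum_(y in S)
      v x * (mask_walk l x z w * mask_walk l z y w * v y)).
    apply: eq_bigr => z zS; rewrite expr2 mulr_suml; apply: eq_bigr => x xS.
    rewrite mulr_sumr; apply: eq_bigr => y yS.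
    by rewrite [mask_walk l x z w]mask_walkC //; ring.
  rewrite exchange_big /=; apply: eq_bigr => x xS; rewrite mul1r exchange_big /= mulr_sumr.
  apply: eq_bigr => y yS; rewrite -addnn mask_walk_cat // mulr_suml mulr_sumr.
  by [].
apply: le_trans (sum_Cauchy_Schwarz _ _ _ _ _ _ (fun=> ler01)) _.
by rewrite le_eqVlt; apply/orP; left; apply/eqP; congr (_ * _); apply: eq_bigr => x _;
  rewrite mul1r.
Qed.

Let iter_norm_trace l : iter_norm l <= sqv * walk_trace l.*2 w.
Proof.
rewrite walk_trace_double mulr_sumr; apply: ler_sum => x _.
have -> : \sum_(y in S) mask_walk l x y w * v y = \sum_(y in S) 1 * (mask_walk l x y w * v y).
  by apply: eq_bigr => y _; rewrite mul1r.
apply: le_trans (sum_Cauchy_Schwarz _ _ _ _ _ _ (fun=> ler01)) _.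
rewrite mulrC le_eqVlt; apply/orP; left; apply/eqP; congr (_ * _); apply: eq_bigr => y _.
  by rewrite mul1r.
by rewrite mul1r.
Qed.

(* |A v|^2 <= |v| |A^2 v| for symmetric A, iterated along powers of two. *)
Lemma masked_block_norm_pow k :
  (\sum_(x in S) (\sum_(y in S) xi w (edge x y) * v y) ^+ 2) ^+ (2 ^ k)
  <= sqv ^+ (2 ^ k) * walk_trace (2 ^ k.+1) w.
Proof.
have -> : \sum_(x in S) (\sum_(y in S) xi w (edge x y) * v y) ^+ 2 = iter_norm 1.
  apply: eq_bigr => x _; congr (_ ^+ 2); apply: eq_bigr => y yS.
  by rewrite mask_walk1.
have step : iter_norm 1 ^+ (2 ^ k) <= sqv ^+ (2 ^ k).-1 * iter_norm (2 ^ k).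
  elim: k => [|k IH]; first by rewrite expn0 /= expr0 mul1r expr1.
  rewrite [X in _ ^+ X <= _]expnSr exprM.
  apply: (@le_trans _ _ ((sqv ^+ (2 ^ k).-1 * iter_norm (2 ^ k)) ^+ 2)).
    by rewrite lerXn2r ?nnegrE ?mulr_ge0 ?exprn_ge0.
  have -> : (2 ^ k.+1).-1 = ((2 ^ k).-1 * 2 + 1)%N.
    by rewrite expnS; have := expn_gt0 2 k; lia.
  rewrite exprMn -exprM exprD expr1 -mulrA; apply: ler_wpM2l; first exact: exprn_ge0.
  have -> : (2 ^ k.+1 = (2 ^ k).*2)%N by rewrite expnS mul2n.
  exact: iter_norm_double.
apply: le_trans step _.
have -> : sqv ^+ (2 ^ k) = sqv ^+ (2 ^ k).-1 * sqv.
  by rewrite -exprSr prednK ?expn_gt0.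
rewrite -mulrA; apply: ler_wpM2l; first exact: exprn_ge0.
have -> : (2 ^ k.+1 = (2 ^ k).*2)%N by rewrite expnS mul2n.
exact: iter_norm_trace.
Qed.

End VectorNorm.

(** The comparisons between [entries_mom] and [trace_mom] that [trace_mom_bound] requires hold for
    each outcome, and are averaged here. *)
Lemma mask_mean_walk_trace_le (N rho : R) l :
  0 < N -> 0 < rho -> rho ^+ 2 = N / p -> #|S|%:R <= N ->
  11 * (l%:R ^+ 2 * p^-1 / rho) < 1 ->
  mask_mean (walk_trace l)
  <= N * rho ^+ l * (2 / (1 - 11 * (l%:R ^+ 2 * p^-1 / rho))) ^+ l.+1.
Proof.
move=> N0 r0 r2 SN D1; rewrite mask_mean_walk_trace.
have q1 : 1 <= p^-1 by move: q_gt2; rewrite /q; lra.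
have even_le k : emom k.*2 <= N * tmom k.*2.
  rewrite -mask_mean_walk_total -mask_mean_walk_trace -mask_meanZ.
  apply: le_mask_mean => w; apply: le_trans (walk_total_even_le _ _) _.
  by apply: ler_wpM2r => //; apply: walk_trace_double_ge0.
apply: trace_mom_bound => //.
- exact: edgeC.
- exact: edge_inj.
- exact: mask_mom_ge0.
- exact: mask_mom_perm.
- exact: mask_mom_disjoint.
- exact: le_trans ler01 q1.
- exact: mask_mom_cons.
- exact: mask_mom_nil.
- exact: mask_mom_seq1.
move=> k; rewrite -mask_mean_walk_total.
apply: (@le_trans _ _ ((rho * emom k.*2 + rho^-1 * emom k.*2.+2) / 2)).
  rewrite -!mask_mean_walk_total -!mask_meanZ -mask_meanD mulrC -mask_meanZ.
  by apply: le_mask_mean => w; rewrite mulrC; apply: walk_total_odd_le.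
have h1 := ler_wpM2l (ltW r0) (even_le k).
have r0' : 0 <= rho^-1 by rewrite invr_ge0 ltW.
have h2 := ler_wpM2l r0' (even_le k.+1).
move: h1 h2; rewrite doubleS; lra.
Qed.

End MaskedBlock.

End Mask.

Arguments mask_mean {R n} p f.
Arguments xi {R n} p w e.
Arguments edge {n} i j.
Arguments walk_trace {R n} p S l w.
Arguments prob_ge0 {R n p} p_gt0 p_lt w.
Arguments mask_mean_ge0 {R n p} p_gt0 p_lt {f} f0.
Arguments le_mask_mean {R n p} p_gt0 p_lt {f g} fg.
Arguments eq_mask_mean {R n p f g} fg.
Arguments mask_mean_Cauchy_Schwarz {R n p} p_gt0 p_lt f g.
Arguments walk_trace_double_ge0 {R n p} p_gt0 p_lt {S} l w.
Arguments masked_block_norm_pow {R n p} p_gt0 p_lt {S} v w k.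
Arguments mask_mean_walk_trace_le {R n p} p_gt0 p_lt {S N rho l}.
Arguments mask_mean_prod {R n p s} us.

(** * Jensen inequalities and the norm of a block *)

Lemma mask_mean_cst (R : realType) n (p c : R) :
  mask_mean p (fun _ : omega n => c) = c.
Proof.
have := mask_mean_prod (R := R) (n := n) (p := p) (s := [::]) isT.
under eq_mask_mean do rewrite big_nil.
rewrite /mask_mom big1 => [|e _]; last by rewrite /centered_mom !expr0 !mulr1 addrC subrK.
by move=> h; rewrite -[c]mulr1 mask_meanZ h.
Qed.

Lemma mask_mean_sqrt_le (R : realType) n (p : R) (f : omega n -> R) :
  0 < p -> p < 1 / 2 -> (forall w, 0 <= f w) ->
  mask_mean p (fun w => Num.sqrt (f w)) <= Num.sqrt (mask_mean p f).
Proof.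
move=> p0 p2 f0.
have s0 : 0 <= mask_mean p (fun w => Num.sqrt (f w)).
  by apply: (mask_mean_ge0 p0 p2) => w; rewrite sqrtr_ge0.
have E0 := mask_mean_ge0 p0 p2 f0.
rewrite -(@ler_pXn2r _ 2) ?nnegrE ?sqrtr_ge0 // [leRHS]sqr_sqrtr //.
have := mask_mean_Cauchy_Schwarz p0 p2 (fun w => Num.sqrt (f w)) (fun=> 1).
under eq_mask_mean do rewrite mulr1.
move=> /le_trans; apply; rewrite expr1n mask_mean_cst mulr1.
by rewrite le_eqVlt; apply/orP; left; apply/eqP; apply: eq_mask_mean => w; rewrite sqr_sqrtr.
Qed.

(** Jensen's inequality for the exponents [2^-k], by iterating the case of the square root. *)
Lemma mask_mean_powR_le (R : realType) n (p : R) (f : omega n -> R) k :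
  0 < p -> p < 1 / 2 -> (forall w, 0 <= f w) ->
  mask_mean p (fun w => f w `^ ((2 ^+ k)^-1)) <= (mask_mean p f) `^ ((2 ^+ k)^-1).
Proof.
move=> p0 p2 f0; elim: k => [|k IH].
  rewrite expr0 invr1 powRr1 ?(mask_mean_ge0 p0 p2) //.
  by apply: (le_mask_mean p0 p2) => w; rewrite powRr1.
have E0 : 0 <= mask_mean p f by exact: (mask_mean_ge0 p0 p2).
rewrite exprSr invfM powRrM powR12_sqrt ?powR_ge0 //.
apply: (le_trans _ (ler_wsqrtr IH)).
apply: le_trans (mask_mean_sqrt_le _ _ _ _ p0 p2 _); last by move=> w; rewrite powR_ge0.
by apply: (le_mask_mean p0 p2) => w; rewrite powRrM powR12_sqrt ?powR_ge0.
Qed.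

(** The exponent is at least two, so that four divided by this power is again the inverse of a power
    of two, as Jensen's inequality for fourth moments demands. *)
Lemma power_of_two_between (R : realType) (x : R) : 4 <= x ->
  exists2 m, x <= 2 ^+ m.+2 & 2 ^+ m.+2 <= 2 * x.
Proof.
move=> x4.
have ex : exists m, x <= 2 ^+ m.
  exists (Num.bound x); apply: le_trans (ltW (archi_boundP _)) _; first by lra.
  by rewrite -natrX ler_nat ltnW // ltn_expl.
case: (ex_minnP ex) => m xm minm.
have m2 : (2 <= m)%N.
  rewrite leqNgt; apply/negP => m1.
  have : 2 ^+ m <= 2 :> R by rewrite -[leRHS]expr1 ler_eXn2l ?ltr1n //; lia.
  by lra.
exists m.-2; have -> : m.-2.+2 = m by lia.
  by [].
have m1 : m = m.-1.+1 by lia.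
rewrite m1 exprS; apply: ler_wpM2l => //; rewrite leNgt; apply/negP => /ltW /minm.
by lia.
Qed.

(* The moment of order l is used for l of order C ln N, so that N^(1/l) is close
   to 1 while l^2 / sqrt (p N) still tends to 0. *)
Lemma mask_norm_moment (R : realType) (eta : R) : 0 < eta ->
  exists2 c : R, 0 < c & forall n (p N : R) (S : {set 'I_n}),
    0 < p -> p < 1 / 2 -> 0 < N -> #|S|%:R <= N -> c^-1 <= ln N -> ln N ^+ 4 <= c * (p * N) ->
    exists2 e : omega n -> R, forall w, 0 <= e w &
      (forall w (v : 'I_n -> R),
         \sum_(x in S) (\sum_(y in S) xi p w (edge x y) * v y) ^+ 2
         <= e w ^+ 2 * \sum_(x in S) v x ^+ 2) /\
      mask_mean p (fun w => e w ^+ 4) <= (2 + eta) ^+ 4 * (N / p) ^+ 2.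
Proof.
(* The margin [eta] is shared between the constant of the trace bound, raised from [2] to [b], and
   the prefactor [N^2], whose root must stay below [theta]. *)
move=> eta0; set b := 2 + eta / 2; set theta := (2 + eta) ^+ 4 / b ^+ 4.
have b2 : 2 < b by rewrite /b; lra.
have b0 : 0 < b by lra.
have theta1 : 1 < theta.
  by rewrite /theta -expr_div_n exprn_egt1 // ltr_pdivlMr // /b; lra.
(* Chosen so that [(N^2)^(4/L) = exp (8 ln N / L) <= theta] as soon as [L >= C ln N]. *)
set C := 8 / ln theta.
have lnt : 0 < ln theta by exact: ln_gt0.
have C0 : 0 < C by rewrite /C divr_gt0.
(* An error [kap <= k0] keeps [2 / (1 - kap)] below [b]. *)
set k0 := 1 - 2 / b.
have k00 : 0 < k0 by rewrite /k0 subr_gt0 ltr_pdivrMr //; lra.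
have k01 : k0 < 1 by rewrite /k0 ltrBlDr ltrDl divr_gt0.
have lnb : 0 < ln b by apply: ln_gt0; lra.
(* The three bounds ensure [C ln N >= 4], [b <= N] and [kap <= k0]. In the last one [44 = 11 * 4],
   the [4] coming from [L <= 2 C ln N] squared. *)
set c := Num.min (C / 4) (Num.min (ln b)^-1 (k0 ^+ 2 / (44 * C ^+ 2) ^+ 2)).
have c0 : 0 < c.
  rewrite /c !lt_min invr_gt0 lnb !divr_gt0 //= ?exprn_gt0 // mulr_gt0 ?exprn_gt0 //.
exists c => // n p N S p0 p2 N0 SN lnN pN.
have cC : 4 / C <= ln N.
  by apply: le_trans lnN; rewrite -[4 / C]invf_div lef_pV2 ?posrE ?divr_gt0 // ge_min lexx.
have cb : ln b <= ln N.
  apply: le_trans lnN; rewrite -[leLHS]invrK lef_pV2 ?posrE ?invr_gt0 // /c.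
  by rewrite !ge_min lexx orbT.
have ck : c <= k0 ^+ 2 / (44 * C ^+ 2) ^+ 2 by rewrite /c !ge_min lexx !orbT.
have lnN0 : 0 < ln N by apply: lt_le_trans cb.
have bN : b <= N by rewrite -ler_ln ?posrE.
have [m CL LC] : exists2 m, C * ln N <= 2 ^+ m.+2 & 2 ^+ m.+2 <= 2 * (C * ln N).
  by apply: power_of_two_between; rewrite mulrC -ler_pdivrMr.
set L := (2 ^ m.+2)%N; set ell : R := 2 ^+ m.+2 in CL LC.
have Lell : L%:R = ell by rewrite natrX.
have ell0 : 0 < ell by rewrite exprn_gt0.
set rho := Num.sqrt (N / p).
have r0 : 0 < rho by rewrite sqrtr_gt0 divr_gt0.
have r2 : rho ^+ 2 = N / p by rewrite sqr_sqrtr // divr_ge0 ?ltW.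
set kap := 11 * (L%:R ^+ 2 * p^-1 / rho).
have kap0 : 0 <= kap by rewrite /kap !mulr_ge0 ?invr_ge0 ?ltW // Lell.
have kapk : kap <= k0.
  have -> : kap = 11 * ell ^+ 2 / (p * rho).
    by rewrite /kap Lell; field; rewrite !gt_eqF.
  rewrite ler_pdivrMr ?mulr_gt0 //.
  have h : (11 * ell ^+ 2) ^+ 2 <= (k0 * (p * rho)) ^+ 2.
    apply: (@le_trans _ _ ((44 * C ^+ 2) ^+ 2 * ln N ^+ 4)).
      have -> : (44 * C ^+ 2) ^+ 2 * ln N ^+ 4 = (11 * (2 * (C * ln N)) ^+ 2) ^+ 2 by ring.
      have y0 : 0 <= 2 * (C * ln N) by apply: le_trans LC; apply: ltW.
      have ll : 11 * ell ^+ 2 <= 11 * (2 * (C * ln N)) ^+ 2.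
        by apply: ler_wpM2l => //; apply: lerXn2r; rewrite ?nnegrE // ltW.
      have l0 : 0 <= 11 * ell ^+ 2 by apply: mulr_ge0 => //; apply: exprn_ge0; apply: ltW.
      by apply: lerXn2r; rewrite ?nnegrE // (le_trans l0 ll).
    have -> : (k0 * (p * rho)) ^+ 2 = k0 ^+ 2 * (p * N).
      by rewrite !exprMn r2; field; rewrite gt_eqF.
    have C440 : 0 < (44 * C ^+ 2) ^+ 2 by rewrite exprn_gt0 // mulr_gt0 // exprn_gt0.
    rewrite mulrC -ler_pdivlMr //; apply: le_trans pN _.
    have := ler_wpM2r (ltW (mulr_gt0 p0 N0)) ck => /le_trans; apply.
    by rewrite mulrAC.
  have y0 : 0 <= k0 * (p * rho) by rewrite !mulr_ge0 ?ltW.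
  have l0 : 0 <= 11 * ell ^+ 2 by apply: mulr_ge0 => //; apply: exprn_ge0; apply: ltW.
  by rewrite -(@ler_pXn2r _ 2) // ?nnegrE.
have kap1 : kap < 1 by apply: le_lt_trans k01.
have trE := mask_mean_walk_trace_le p0 p2 N0 r0 r2 SN kap1.
rewrite -/kap in trE.
set B := 2 / (1 - kap) in trE.
have B0 : 0 < B by rewrite divr_gt0 // subr_gt0.
have Bb : B <= b.
  rewrite /B ler_pdivrMr ?subr_gt0 // mulrC -ler_pdivrMr //; move: kapk; rewrite /k0; lra.
have LD : L = (2 ^ m.+1).*2 by rewrite /L expnS mul2n.
have tr0 w : 0 <= walk_trace p S L w by rewrite LD (walk_trace_double_ge0 p0 p2).
(* For [X] symmetric and [L] even, [tr X^L] is at least the [L]-th power of the norm of [X]. *)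
exists (fun w => walk_trace p S L w `^ (L%:R^-1)) => [w|]; first exact: powR_ge0.
have LN0 : (L%:R : R) != 0 by rewrite Lell gt_eqF.
split.
  move=> w v; set X := \sum_(x in S) _; set Y := \sum_(x in S) _.
  have X0 : 0 <= X by apply: sumr_ge0 => x _; rewrite sqr_ge0.
  have Y0 : 0 <= Y by apply: sumr_ge0 => x _; rewrite sqr_ge0.
  rewrite -(@ler_pXn2r _ (2 ^ m.+1)) ?expn_gt0 ?nnegrE ?mulr_ge0 ?exprn_ge0 ?powR_ge0 //.
  apply: le_trans (masked_block_norm_pow p0 p2 v w m.+1) _.
  rewrite exprMn mulrC -exprM -expnS -/L; apply: ler_wpM2r; first exact: exprn_ge0.
  by rewrite -powR_mulrn ?powR_ge0 // -powRrM mulVf // powRr1.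
have eE w : (walk_trace p S L w `^ L%:R^-1) ^+ 4 = walk_trace p S L w `^ ((2 ^+ m)^-1).
  rewrite -powR_mulrn ?powR_ge0 // -powRrM; congr (_ `^ _).
  by rewrite Lell /ell 2!exprS; field; rewrite expf_neq0.
rewrite (eq_mask_mean eE).
apply: le_trans (mask_mean_powR_le _ _ _ _ m p0 p2 tr0) _.
set x := (2 ^+ m)^-1.
have x0 : 0 <= x by rewrite invr_ge0 exprn_ge0.
have xE : x = 4 / ell by rewrite /x /ell 2!exprS; field; rewrite expf_neq0.
have T0 : 0 <= mask_mean p (walk_trace p S L) by exact: (mask_mean_ge0 p0 p2).
apply: (@le_trans _ _ ((N * rho ^+ L * B ^+ L.+1) `^ x)).
  by apply: ge0_ler_powR => //; rewrite nnegrE ?(le_trans T0).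
(* The exponent [L.+1] leaves one factor [B] in excess, at most [b <= N]; this is where the second
   [N] comes from. *)
apply: (@le_trans _ _ (((rho * b) ^+ L * (N * N)) `^ x)).
  apply: ge0_ler_powR => //; rewrite ?nnegrE ?mulr_ge0 ?exprn_ge0 ?(ltW N0) ?(ltW r0) ?(ltW B0) ?mulr_ge0 ?(ltW r0) ?(ltW b0) //.
  have -> : N * rho ^+ L * B ^+ L.+1 = rho ^+ L * N * (B ^+ L * B) by rewrite exprSr; ring.
  have -> : (rho * b) ^+ L * (N * N) = rho ^+ L * N * (b ^+ L * N) by rewrite exprMn; ring.
  apply: ler_wpM2l; first by rewrite mulr_ge0 ?exprn_ge0 ?(ltW r0) ?(ltW N0).
  apply: ler_pM; rewrite ?exprn_ge0 ?(ltW B0) ?(le_trans Bb) //.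
  by rewrite lerXn2r ?nnegrE ?(ltW b0) ?(ltW B0).
rewrite powRM ?exprn_ge0 ?mulr_ge0 ?(ltW N0) ?(ltW r0) ?(ltW b0) //.
have -> : ((rho * b) ^+ L) `^ x = (rho * b) ^+ 4.
  have rb0 : 0 <= rho * b by rewrite mulr_ge0 ?ltW.
  rewrite -!powR_mulrn // -powRrM; congr (_ `^ _).
  by rewrite Lell xE; field; rewrite gt_eqF.
have h : (N * N) `^ x <= theta.
  rewrite -expr2 -powR_mulrn ?(ltW N0) // -powRrM /powR gt_eqF //.
  rewrite -[leRHS]lnK ?posrE ?(lt_trans ltr01) // ler_expR xE.
  have -> : 2 * (4 / ell) * ln N = 8 * ln N / ell by ring.
  rewrite ler_pdivrMr //.
  have -> : 8 * ln N = ln theta * (C * ln N) by rewrite /C; field; rewrite gt_eqF.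
  by apply: ler_wpM2l => //; exact: ltW.
have -> : (2 + eta) ^+ 4 * (N / p) ^+ 2 = (rho * b) ^+ 4 * theta.
  by rewrite -r2 /theta; field; rewrite gt_eqF.
by apply: ler_wpM2l => //; rewrite exprn_ge0 // mulr_ge0 ?ltW.
Qed.

(** * Euclidean norm and Rayleigh quotients *)

Set Implicit Arguments.
Unset Strict Implicit.
Unset Printing Implicit Defensive.

Section EuclideanNorm.
Variable R : realType.

Definition dot n (x y : 'cV[R]_n) : R := (x^T *m y) 0 0.

Lemma dotE n (x y : 'cV[R]_n) : dot x y = \sum_i x i 0 * y i 0.
Proof. by rewrite /dot mxE; apply: eq_bigr => i _; rewrite mxE. Qed.

Lemma dotC n (x y : 'cV[R]_n) : dot x y = dot y x.
Proof. by rewrite !dotE; apply: eq_bigr => i _; rewrite mulrC. Qed.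

Lemma dotDr n (x y z : 'cV[R]_n) : dot x (y + z) = dot x y + dot x z.
Proof. by rewrite /dot mulmxDr mxE. Qed.

Lemma dotZr n (x y : 'cV[R]_n) c : dot x (c *: y) = c * dot x y.
Proof. by rewrite /dot -scalemxAr mxE. Qed.

Lemma dotDl n (x y z : 'cV[R]_n) : dot (x + y) z = dot x z + dot y z.
Proof. by rewrite dotC dotDr !(dotC z). Qed.

Lemma dotZl n (x y : 'cV[R]_n) c : dot (c *: x) y = c * dot x y.
Proof. by rewrite dotC dotZr dotC. Qed.

Lemma dot_mulmx m n (A : 'M[R]_(m, n)) x y : dot x (A *m y) = dot (A^T *m x) y.
Proof. by rewrite /dot trmx_mul trmxK mulmxA. Qed.

Lemma enorm_ge0 n (x : 'cV[R]_n) : 0 <= enorm x.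
Proof. exact: sqrtr_ge0. Qed.

Lemma enorm_sqr n (x : 'cV[R]_n) : enorm x ^+ 2 = dot x x.
Proof.
rewrite /enorm sqr_sqrtr ?dotE; first by apply: eq_bigr => i _; rewrite expr2.
by apply: sumr_ge0 => i _; rewrite sqr_ge0.
Qed.

Lemma enorm_eq0 n (x : 'cV[R]_n) : enorm x = 0 -> x = 0.
Proof.
move=> x0; have : \sum_i (x i 0) ^+ 2 = 0.
  transitivity (dot x x); last by rewrite -enorm_sqr x0 expr0n.
  by rewrite dotE; apply: eq_bigr => i _; rewrite expr2.
move=> /psumr_eq0P h; apply/matrixP => i j; rewrite ord1 mxE.
by apply/eqP; rewrite -sqrf_eq0; apply/eqP/h => // k _; rewrite sqr_ge0.
Qed.

Lemma enorm0 n : enorm (0 : 'cV[R]_n) = 0.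
Proof. by rewrite /enorm big1 ?sqrtr0 // => i _; rewrite mxE expr0n. Qed.

Lemma enorm_gt0 n (x : 'cV[R]_n) : (0 < enorm x) = (x != 0).
Proof.
rewrite lt0r enorm_ge0 andbT; apply/negP/negP; apply: contra_not => /eqP.
  by move=> ->; rewrite enorm0.
by move=> /enorm_eq0 ->.
Qed.

Lemma enorm_le n (x : 'cV[R]_n) c : 0 <= c -> dot x x <= c ^+ 2 -> enorm x <= c.
Proof. by move=> c0; rewrite -enorm_sqr ler_pXn2r ?nnegrE ?enorm_ge0. Qed.

Lemma enormZ n (x : 'cV[R]_n) c : enorm (c *: x) = `|c| * enorm x.
Proof.
apply/eqP; rewrite -(@eqrXn2 _ 2) ?enorm_ge0 ?mulr_ge0 ?enorm_ge0 //.
by rewrite exprMn !enorm_sqr dotZl dotZr -normrX ger0_norm ?sqr_ge0 // mulrA expr2.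
Qed.

Lemma enormN n (x : 'cV[R]_n) : enorm (- x) = enorm x.
Proof. by rewrite -scaleN1r enormZ normrN1 mul1r. Qed.

Lemma dot_le n (x y : 'cV[R]_n) : `|dot x y| <= enorm x * enorm y.
Proof.
rewrite -(@ler_pXn2r _ 2) ?nnegrE ?mulr_ge0 ?enorm_ge0 //.
rewrite exprMn !enorm_sqr -normrX ger0_norm ?sqr_ge0 // !dotE.
have := sum_Cauchy_Schwarz _ _ xpredT (fun=> 1) (fun i => x i 0) (fun i => y i 0) (fun=> ler01).
under eq_bigr do rewrite mul1r.
under [X in _ <= X * _]eq_bigr do rewrite mul1r.
by under [X in _ <= _ * X]eq_bigr do rewrite mul1r.
Qed.

Lemma enormD n (x y : 'cV[R]_n) : enorm (x + y) <= enorm x + enorm y.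
Proof.
apply: enorm_le; first by rewrite addr_ge0 ?enorm_ge0.
rewrite dotDl !dotDr sqrrD !enorm_sqr (dotC y x).
by have := dot_le x y; rewrite ler_norml => /andP[_ h]; lra.
Qed.

Lemma enormB n (x y : 'cV[R]_n) : enorm (x - y) <= enorm x + enorm y.
Proof. by rewrite -(enormN y) enormD. Qed.

Lemma enorm_sum n (I : Type) (r : seq I) (P : pred I) (F : I -> 'cV[R]_n) :
  enorm (\sum_(i <- r | P i) F i) <= \sum_(i <- r | P i) enorm (F i).
Proof.
elim/big_ind2: _ => [|x a y b xa yb|//]; first by rewrite enorm0.
by apply: le_trans (enormD _ _) _; apply: lerD.
Qed.

Lemma enorm_orthogonal n (A : 'M[R]_n) x : A^T *m A = 1%:M -> enorm (A *m x) = enorm x.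
Proof.
move=> AA; apply/eqP; rewrite -(@eqrXn2 _ 2) ?enorm_ge0 //.
by rewrite !enorm_sqr dot_mulmx mulmxA AA mul1mx.
Qed.

Lemma enorm_diag_mx n (d : 'rV[R]_n) c (x : 'cV[R]_n) : (forall i, `|d 0 i| <= c) ->
  enorm (diag_mx d *m x) <= c * enorm x.
Proof.
case: n d x => [|n] d x dc; first by rewrite /enorm !big_ord0 sqrtr0 mulr0.
have c0 : 0 <= c by apply: le_trans (dc 0).
apply: enorm_le; first by rewrite mulr_ge0 ?enorm_ge0.
rewrite exprMn enorm_sqr !dotE mulr_sumr; apply: ler_sum => i _.
rewrite mul_diag_mx !mxE mulrACA -!expr2; apply: ler_wpM2r; first exact: sqr_ge0.
by rewrite -real_normK ?num_real // lerXn2r ?nnegrE.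
Qed.

(** Any finite bound will do: it makes the [sup] in [opnorm] a genuine supremum. *)
Lemma mulmx_bounded m n (A : 'M[R]_(m, n)) :
  exists2 c, 0 <= c & forall x, enorm (A *m x) <= c * enorm x.
Proof.
exists (\sum_j enorm (col j A)); first by apply: sumr_ge0 => j _; exact: enorm_ge0.
move=> x; have -> : A *m x = \sum_j x j 0 *: col j A.
  apply/matrixP => i k; rewrite ord1 mxE summxE; apply: eq_bigr => j _.
  by rewrite !mxE mulrC.
apply: le_trans (enorm_sum _ _ _) _; rewrite mulr_suml; apply: ler_sum => j _.
rewrite enormZ mulrC; apply: ler_wpM2l; first exact: enorm_ge0.
rewrite -(@ler_pXn2r _ 2) ?nnegrE ?enorm_ge0 // enorm_sqr real_normK ?num_real //.
by rewrite dotE (bigD1 j) //= -expr2 lerDl; apply: sumr_ge0 => k _; rewrite -expr2 sqr_ge0.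
Qed.

Lemma enorm_opnorm m n (A : 'M[R]_(m, n)) x : enorm (A *m x) <= opnorm A * enorm x.
Proof.
have [->|x0] := eqVneq x 0; first by rewrite mulmx0 !enorm0 mulr0.
have nx : 0 < enorm x by rewrite enorm_gt0.
rewrite -ler_pdivrMr //; apply: ub_le_sup.
  have [c _ Ac] := mulmx_bounded A; exists c => _ [y /= y1 <-].
  by have := Ac y; rewrite y1 mulr1.
exists ((enorm x)^-1 *: x) => /=.
  by rewrite enormZ ger0_norm ?invr_ge0 ?enorm_ge0 // mulVf ?gt_eqF.
by rewrite -scalemxAr enormZ ger0_norm ?invr_ge0 ?enorm_ge0 // mulrC.
Qed.

(** Positive dimension provides a unit vector, so that the supremum is over a nonempty set. *)
Lemma opnorm_le m n (A : 'M[R]_(m, n.+1)) c :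
  (forall x, enorm (A *m x) <= c * enorm x) -> opnorm A <= c.
Proof.
move=> Ac; apply: ge_sup.
  exists (enorm (A *m delta_mx 0 0)), (delta_mx 0 0) => //=.
  rewrite /enorm (bigD1 0) //= mxE !eqxx expr1n big1 ?addr0 ?sqrtr1 //.
  by move=> i /negbTE i0; rewrite mxE i0 expr0n.
by move=> _ [x /= x1 <-]; have := Ac x; rewrite x1 mulr1.
Qed.

Lemma continuous_sum (T : topologicalType) (I : Type) (r : seq I) (F : I -> T -> R) :
  (forall i, continuous (F i)) -> continuous (fun v => \sum_(i <- r) F i v).
Proof.
move=> cF; elim: r => [|i r IH] v.
  under eq_fun do rewrite big_nil; exact: cvg_cst.
under eq_fun do rewrite big_cons.
exact: (cvgD (cF i v) (IH v)).
Qed.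

(** The quadratic form is continuous on the unit sphere, a closed subset of a compact cube. The
    sphere is taken among row vectors, where [rV_compact] applies. *)
Lemma Rayleigh_max_exists n (S : 'M[R]_n.+1) :
  exists2 x : 'cV[R]_n.+1, enorm x = 1 &
    forall y, dot y (S *m y) <= dot x (S *m x) * enorm y ^+ 2.
Proof.
pose f (v : 'rV[R]_n.+1) : R := \sum_i \sum_j v 0 i * S i j * v 0 j.
pose g (v : 'rV[R]_n.+1) : R := \sum_i v 0 i * v 0 i.
have fE (y : 'cV[R]_n.+1) : f y^T = dot y (S *m y).
  rewrite dotE; apply: eq_bigr => i _; rewrite [(S *m y) i 0]mxE mulr_sumr; apply: eq_bigr => j _.
  by rewrite !mxE mulrA.
have gE (y : 'cV[R]_n.+1) : g y^T = enorm y ^+ 2.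
  by rewrite enorm_sqr dotE; apply: eq_bigr => i _; rewrite !mxE.
have cf : continuous f.
  apply: continuous_sum => i; apply: continuous_sum => j v.
  exact: (cvgM (cvgM (@coord_continuous _ _ _ 0 i v) (cvg_cst _)) (@coord_continuous _ _ _ 0 j v)).
have cg : continuous g.
  by apply: continuous_sum => i v; exact: (cvgM (@coord_continuous _ _ _ 0 i v) (@coord_continuous _ _ _ 0 i v)).
pose A := [set v : 'rV[R]_n.+1 | g v = 1].
have clA : closed A.
  have -> : A = g @^-1` [set 1] by [].
  by apply: preimage_closed => //; exact: closed_eq.
have cA : compact A.
  pose B := [set v : 'rV[R]_n.+1 | forall i, `[(-1 : R), 1]%classic (v ord0 i)].
  have cB : compact B by apply: (@rV_compact _ _ (fun=> `[(-1 : R), 1]%classic)) => i; exact: segment_compact.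
  apply: subclosed_compact clA cB _ => v Av i /=.
  rewrite in_itv /= -ler_norml -(@ler_pXn2r _ 2) ?nnegrE // expr1n real_normK ?num_real //.
  rewrite -Av /g (bigD1 i) //= expr2 lerDl; apply: sumr_ge0 => k _.
  by rewrite -expr2 sqr_ge0.
have A0 : A !=set0.
  exists (delta_mx 0 0); rewrite /A /g /= (bigD1 0) //= mxE !eqxx mulr1 big1 ?addr0 //.
  by move=> i /negbTE i0; rewrite mxE i0 andbF mulr0.
have [c cA' cmax] := compact_EVT_max A0 cA (continuous_subspaceT cf).
move: cA'; rewrite inE => cA'.
have cn : enorm c^T = 1.
  apply/eqP; rewrite -(@eqrXn2 _ 2) ?enorm_ge0 // -gE trmxK expr1n; exact/eqP.
exists c^T => // y; rewrite -(fE c^T) trmxK.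
have [->|y0] := eqVneq y 0; first by rewrite mulmx0 enorm0 expr0n mulr0 dotE big1 // => i _; rewrite mxE mul0r.
have ny : 0 < enorm y by rewrite enorm_gt0.
have := cmax ((enorm y)^-1 *: y)^T; rewrite inE => /(_ _).
rewrite fE -scalemxAr dotZl dotZr mulrA -expr2 exprVn mulrC ler_pdivrMr ?exprn_gt0 //.
apply; rewrite /A /= gE enormZ ger0_norm ?invr_ge0 ?enorm_ge0 //.
by rewrite mulVf ?gt_eqF // expr1n.
Qed.

(* Positivity of the form at x + t A x for small t < 0. *)
Lemma psd_kernel n (A : 'M[R]_n) x : A^T = A -> (forall y, 0 <= dot y (A *m y)) ->
  dot x (A *m x) = 0 -> A *m x = 0.
Proof.
move=> AT psd x0; apply: enorm_eq0; apply/eqP; rewrite -sqrf_eq0 enorm_sqr.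
set z := A *m x; set a := dot z z; set b := dot z (A *m z).
have a0 : 0 <= a by rewrite /a -enorm_sqr sqr_ge0.
have b0 : 0 <= b by exact: psd.
have key t : 0 <= t * (2 * a + t * b).
  have := psd (x + t *: z); rewrite mulmxDr -scalemxAr dotDl !dotDr x0 !dotZl !dotZr.
  have -> : dot x (A *m z) = a by rewrite dot_mulmx AT.
  by rewrite -/a -/b; lra.
(* The minimum would be at [- a / b]; the [+ 1] guards against [b = 0]. *)
have := key (- (a / (b + 1))).
have b1 : 0 < b + 1 by lra.
have -> : - (a / (b + 1)) * (2 * a + - (a / (b + 1)) * b) = - (a ^+ 2 * (b + 2) / (b + 1) ^+ 2).
  by field; rewrite gt_eqF.
rewrite oppr_ge0 => h.
have : a ^+ 2 * (b + 2) <= 0 by rewrite -(pmulr_lle0 _ (_ : 0 < ((b + 1) ^+ 2)^-1)) ?invr_gt0 ?exprn_gt0 // mulrC.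
by rewrite pmulr_lle0 ?sqrf_eq0; [rewrite le_eqVlt ltNge sqr_ge0 orbF sqrf_eq0|lra].
Qed.

(** For a maximizer [x] of the Rayleigh quotient with value [l], the form of [l - S] is nonnegative
    and vanishes at [x], so [x] lies in its kernel. The set in the definition of [lam_max] is then
    the singleton of [l], and [xget] does not fall back on its default. *)
Lemma lam_max_spec n (S : 'M[R]_n.+1) : S^T = S ->
  (exists2 x, enorm x = 1 & S *m x = lam_max S *: x) /\
  forall y, dot y (S *m y) <= lam_max S * enorm y ^+ 2.
Proof.
move=> ST; have [x x1 xmax] := Rayleigh_max_exists S.
set l := dot x (S *m x) in xmax.
have Sx : S *m x = l *: x.
  apply/eqP; rewrite eq_sym -subr_eq0 -mul_scalar_mx -mulmxBl; apply/eqP.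
  apply: psd_kernel.
  - by rewrite linearB /= tr_scalar_mx ST.
  - move=> y; rewrite mulmxBl dotDr mul_scalar_mx dotZr -scaleN1r dotZr -enorm_sqr.
    by have := xmax y; lra.
  - rewrite mulmxBl dotDr mul_scalar_mx dotZr -scaleN1r dotZr -enorm_sqr x1 -/l; lra.
have lP : is_eigenvalue S l /\ forall l', is_eigenvalue S l' -> l' <= l.
  split; first by exists x => //; rewrite -enorm_gt0 x1.
  move=> l' [y y0 Sy]; have := xmax y; rewrite Sy dotZr -enorm_sqr ler_pM2r //.
  by rewrite exprn_gt0 // enorm_gt0.
have -> : lam_max S = l.
  apply: (xget_unique 0 lP) => l' [el' l'max]; apply/eqP; rewrite eq_le.
  by rewrite (lP.2 _ el') (l'max _ lP.1).
by split; first by exists x.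
Qed.

End EuclideanNorm.

(** * Perturbation of the leading eigenvector *)

Section Perturbation.
Variables (R : realType) (n : nat) (M : 'M[R]_n.+1) (lam : 'I_n.+1 -> R)
  (U : 'M[R]_n.+1) (p eps d : R).
Hypothesis UU : U^T *m U = 1%:M.
Hypothesis ME : M = \sum_i lam i *: (col i U *m (col i U)^T).
Hypothesis d_gt0 : 0 < d.
Hypothesis gap : forall j, j != ord0 -> d <= lam ord0 - lam j.

Let u := uvec U.

Lemma sum_col_diag_mx (c : 'I_n.+1 -> R) :
  \sum_j c j *: (col j U *m (col j U)^T) = U *m diag_mx (\row_j c j) *m U^T.
Proof.
apply/matrixP => i k; rewrite summxE mxE; apply: eq_bigr => j _.
by rewrite mul_mx_diag !mxE big_ord1 !mxE; ring.
Qed.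

Let UU' : U *m U^T = 1%:M.
Proof. exact: mulmx1C. Qed.

Let enorm_UT (x : 'cV[R]_n.+1) : enorm (U^T *m x) = enorm x.
Proof. by apply: enorm_orthogonal; rewrite trmxK. Qed.

Let r : 'rV[R]_n.+1 := \row_j (if j != ord0 then (lam j - lam ord0)^-1 else 0).

Let Rmat_diag : Rmat lam U = U *m diag_mx r *m U^T.
Proof.
rewrite -sum_col_diag_mx /Rmat big_mkcond; apply: eq_bigr => j _.
by case: ifP => // _; rewrite scale0r.
Qed.

Let M_diag : M = U *m diag_mx (\row_j lam j) *m U^T.
Proof. by rewrite -sum_col_diag_mx. Qed.

Let UTu : U^T *m u = delta_mx ord0 0.
Proof. by rewrite /u /uvec colE mulmxA UU mul1mx. Qed.

Lemma enorm_uvec : enorm u = 1.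
Proof.
rewrite -enorm_UT UTu /enorm (bigD1 ord0) //= mxE !eqxx expr1n big1 ?addr0 ?sqrtr1 //.
by move=> i /negbTE i0; rewrite mxE i0 expr0n.
Qed.

Lemma enorm_Rmat x : enorm (Rmat lam U *m x) <= d^-1 * enorm x.
Proof.
rewrite Rmat_diag -2!mulmxA enorm_orthogonal // -(enorm_UT x).
apply: enorm_diag_mx => j; rewrite mxE; case: ifP => [j0|_]; last first.
  by rewrite normr0 invr_ge0 ltW.
have h := gap j0; have lj : lam j - lam ord0 < 0 by move: d_gt0; lra.
rewrite normfV ltr0_norm // opprB lef_pV2 ?posrE //.
by move: d_gt0; lra.
Qed.

Lemma Rmat_uvec : Rmat lam U *m u = 0.
Proof.
rewrite Rmat_diag -mulmxA UTu -mulmxA; have -> : diag_mx r *m delta_mx ord0 0 = 0 :> 'cV[R]_n.+1.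
  apply/matrixP => i j; rewrite mul_diag_mx !mxE; have [->|i0] := eqVneq i ord0.
    by rewrite mul0r.
  by rewrite mulr0.
by rewrite mulmx0.
Qed.

(** [Rmat] is the reduced resolvent: it inverts [M - lam_1] on the orthogonal complement of [u],
    onto which the right side projects. *)
Lemma Rmat_resolvent : Rmat lam U *m (M - (lam ord0)%:M) = 1%:M - u *m u^T.
Proof.
have -> : M - (lam ord0)%:M = U *m diag_mx (\row_j (lam j - lam ord0)) *m U^T.
  have -> : (lam ord0)%:M = U *m diag_mx (\row_j lam ord0) *m U^T.
    have -> : diag_mx (\row_j lam ord0) = (lam ord0)%:M :> 'M[R]_n.+1.
      by apply/matrixP => i j; rewrite !mxE.
    by rewrite -mulmxA mul_scalar_mx -scalemxAr UU' scalemx1.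
  rewrite M_diag -mulmxBl -mulmxBr; congr (_ *m _ *m _).
  by apply/matrixP => i j; rewrite !mxE -mulrnBl.
rewrite Rmat_diag !mulmxA -(mulmxA _ U^T U) UU mulmx1 -(mulmxA U).
have -> : diag_mx r *m diag_mx (\row_j (lam j - lam ord0)) = 1%:M - delta_mx ord0 ord0.
  apply/matrixP => i j; rewrite mul_diag_mx !mxE.
  have [<-|ij] := eqVneq i j; last first.
    rewrite !mulr0n mulr0 sub0r; case: eqP => //= i0; last by rewrite oppr0.
    by rewrite -i0 eq_sym (negbTE ij) oppr0.
  have [i0|i0] := eqVneq i ord0; first by rewrite i0 mul0r subrr.
  rewrite mulr1n subr0 mulVf // subr_eq0.
  by have := gap i0; move: d_gt0 => d0 h; apply/eqP => h'; move: h; rewrite h'; lra.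
rewrite mulmxBr mulmxBl mulmx1 UU'; congr (_ - _).
have -> : delta_mx ord0 ord0
    = (delta_mx ord0 0 : 'cV[R]_n.+1) *m (delta_mx ord0 0 : 'cV[R]_n.+1)^T.
  by rewrite trmx_delta mul_delta_mx.
by rewrite mulmxA -mulmxA -trmx_mul /u /uvec colE.
Qed.

Lemma quad_form_le x : dot x (M *m x) <= lam ord0 * enorm x ^+ 2.
Proof.
rewrite M_diag -2!mulmxA dot_mulmx -(enorm_UT x); set y := U^T *m x.
rewrite enorm_sqr !dotE mulr_sumr; apply: ler_sum => j _.
rewrite mul_diag_mx !mxE.
have lj : lam j <= lam ord0.
  by have [->//|j0] := eqVneq j ord0; have := gap j0; move: d_gt0; lra.
have := ler_wpM2r (sqr_ge0 (y j 0)) lj.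
by rewrite mxE; lra.
Qed.

Lemma M_uvec : M *m u = lam ord0 *: u.
Proof.
rewrite M_diag -mulmxA UTu -mulmxA /u /uvec colE scalemxAr; congr (_ *m _).
apply/matrixP => i j; rewrite mul_diag_mx !mxE; have [->//|i0] := eqVneq i ord0.
by rewrite !mulr0.
Qed.

Lemma M_sym : M^T = M.
Proof. by rewrite M_diag !trmx_mul trmxK tr_diag_mx mulmxA. Qed.

Section Outcome.
Variable w : omega n.+1.

Let S := Smat M p w.
Let E := Emat M p w.
Let D := Delta M lam U p w.
Let RR := Rmat lam U.
Let delta := lam_max S - lam ord0.

Lemma Smat_sym : S^T = S.
Proof.
apply/matrixP => i j; rewrite !mxE.
have -> : M j i = M i j by have := congr1 (fun A : 'M[R]_n.+1 => A i j) M_sym; rewrite mxE.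
congr (_ * _); suff -> : (if (j <= i)%N then (j, i) else (i, j))
  = (if (i <= j)%N then (i, j) else (j, i)) by [].
case: (leqP i j) => [ij|/ltnW ->] //; case: leqP => // ji.
by have -> : i = j by apply: val_inj => /=; lia.
Qed.

Let SE : S = M + E.
Proof. by rewrite /E /Emat addrC subrK. Qed.

Lemma Delta_uvec : D *m u = RR *m E *m u.
Proof.
by rewrite /D /Delta mulmxBr mulmxBl mul_mx_scalar -scalemxAl Rmat_uvec scaler0 subr0.
Qed.

(* The eigenvector equation (M + E) x = (lam_1 + delta) x, multiplied by R. *)
Lemma Delta_eigenvector x : S *m x = lam_max S *: x ->
  (1%:M + D) *m x = dot u x *: u.
Proof.
move=> Sx.
have Mx : (M - (lam ord0)%:M) *m x = - ((E - delta%:M) *m x).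
  have Ex : E *m x = lam_max S *: x - M *m x.
    by rewrite -Sx SE [(M + E) *m x]mulmxDl addrAC subrr add0r.
  rewrite [(M - _) *m x]mulmxBl [(E - _) *m x]mulmxBl !mul_scalar_mx Ex /delta scalerBl.
  by rewrite !opprB [RHS]addrC addrA subrK.
have := congr1 (mulmx RR) Mx.
rewrite mulmxA Rmat_resolvent mulmxN [(1%:M - _) *m x]mulmxBl mul1mx => h.
rewrite mulmxDl mul1mx /D /Delta -/E -/delta -mulmxA -/RR.
have -> : RR *m ((E - delta%:M) *m x) = - (x - u *m u^T *m x) by rewrite h opprK.
rewrite opprB addrC subrK -mulmxA.
have -> : u^T *m x = (dot u x)%:M by apply/matrixP => i j; rewrite !ord1 !mxE eqxx mulr1n /dot mxE.
by rewrite mul_mx_scalar.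
Qed.

(** Uniqueness comes from [(Id + Delta) v = u]. For existence, a leading eigenvector of [S]
    orthogonal to [u] would lie in the kernel of [Id + Delta], so it can be normalized, and [xget]
    returns a true eigenvector. *)
Lemma vvec_invmx : 1%:M + D \in unitmx -> vvec M U p w = invmx (1%:M + D) *m u.
Proof.
move=> uD.
have sol v : S *m v = lam_max S *: v /\ (v^T *m u) 0 0 = 1 -> v = invmx (1%:M + D) *m u.
  move=> [Sv vu]; have := Delta_eigenvector Sv.
  have -> : dot u v = 1 by rewrite dotC.
  by rewrite scale1r => <-; rewrite mulKmx.
have [[x x1 Sx] _] := lam_max_spec Smat_sym.
have h := Delta_eigenvector Sx.
have ux0 : dot u x != 0.
  apply/eqP => ux; move: h; rewrite ux scale0r => h.
  have x0 : x = 0 by rewrite -(mulKmx uD x) h mulmx0.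
  by move: x1; rewrite x0 enorm0 => /eqP; rewrite eq_sym oner_eq0.
have ex : exists v : 'cV[R]_n.+1, S *m v = lam_max S *: v /\ (v^T *m u) 0 0 = 1.
  exists ((dot u x)^-1 *: x); split.
    by rewrite -scalemxAr Sx !scalerA mulrC.
  by rewrite -[LHS]/(dot _ u) dotZl (dotC x) mulVf.
exact: sol (xgetPex (uvec U) ex).
Qed.

(** With [z = R E u = Delta u], one has [u - v = (Id + Delta)^-1 z], expanded here with its exact
    remainder. Outside the good event [vtilde] is this expansion cut before the remainder. *)
Lemma uvec_sub_vtilde : u - vtilde M lam U p eps w = RR *m E *m u - D *m (RR *m E *m u)
  + (if good M lam U p eps w then invmx (1%:M + D) *m (D *m (D *m (RR *m E *m u))) else 0).
Proof.
rewrite /vtilde -/u -/RR -/E -/D; set z := RR *m E *m u.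
have zE : z = D *m u by rewrite Delta_uvec.
have -> : D *m RR *m E *m u = D *m z by rewrite /z !mulmxA.
case: ifP => [/andP[uD _]|_]; last by rewrite addr0 opprD opprB !addrA [u + z]addrC addrK.
rewrite vvec_invmx //; set y := D *m (D *m z).
apply: (can_inj (mulKmx uD)); rewrite mulmxBr mulmxDr !mulKVmx //.
rewrite [(1%:M + D) *m u]mulmxDl [(1%:M + D) *m (z - _)]mulmxDl !mul1mx -zE mulmxBr -/y.
by rewrite [u + z]addrC addrK addrA subrK subrK.
Qed.

Variable e : R.
Hypothesis normE : forall x, enorm (E *m x) <= e * enorm x.

Let e_ge0 : 0 <= e.
Proof. by have := normE u; rewrite enorm_uvec mulr1; apply: le_trans; exact: enorm_ge0. Qed.

Let dotE_le x : `|dot x (E *m x)| <= e * enorm x ^+ 2.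
Proof.
have h := ler_wpM2l (enorm_ge0 x) (normE x).
by apply: le_trans (dot_le _ _) (le_trans h _); rewrite mulrCA -expr2.
Qed.

(** Weyl's inequality: test the form of [S] at [u] for the lower bound, and that of [M] at a leading
    eigenvector of [S] for the upper one. *)
Lemma lam_max_shift : `|delta| <= e.
Proof.
have [[x x1 Sx] Smax] := lam_max_spec Smat_sym.
rewrite ler_norml /delta; apply/andP; split.
  have := Smax u; rewrite enorm_uvec SE mulmxDl dotDr M_uvec dotZr -enorm_sqr enorm_uvec.
  by have := dotE_le u; rewrite enorm_uvec ler_norml => /andP[h _]; rewrite -SE; lra.
have : dot x (S *m x) = lam_max S by rewrite Sx dotZr -enorm_sqr x1 expr1n mulr1.
rewrite {1}SE mulmxDl dotDr.
have := quad_form_le x; have := dotE_le x; rewrite x1 ler_norml => /andP[_].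
by lra.
Qed.

Lemma enorm_Delta x : enorm (D *m x) <= 2 * e / d * enorm x.
Proof.
rewrite /D /Delta -/E -/S -mulmxA; apply: le_trans (enorm_Rmat _) _.
rewrite [2 * e / d]mulrC -mulrA; apply: ler_wpM2l; first by rewrite invr_ge0 ltW.
rewrite mulmxBl mul_scalar_mx; apply: le_trans (enormB _ _) _; rewrite enormZ.
have := normE x; have := ler_wpM2r (enorm_ge0 x) lam_max_shift; rewrite /delta; lra.
Qed.

Lemma enorm_first_order :
  enorm (D *m (RR *m E *m u)) <= 2 / d ^+ 2 * (e * enorm (E *m u)).
Proof.
apply: le_trans (enorm_Delta _) _.
have -> : 2 / d ^+ 2 * (e * enorm (E *m u)) = 2 * e / d * (d^-1 * enorm (E *m u)).
  by field; rewrite gt_eqF.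
apply: ler_wpM2l; first by rewrite !mulr_ge0 // invr_ge0 ltW.
by rewrite -mulmxA; apply: enorm_Rmat.
Qed.

Lemma enorm_second_order : 0 < eps ->
  enorm (if good M lam U p eps w then invmx (1%:M + D) *m (D *m (D *m (RR *m E *m u))) else 0)
  <= 4 / (eps * d ^+ 3) * (e ^+ 2 * enorm (E *m u)).
Proof.
move=> eps0; case: ifP => [/andP[_ gD]|_]; last first.
  by rewrite enorm0 !mulr_ge0 ?invr_ge0 ?mulr_ge0 ?exprn_ge0 ?enorm_ge0 ?(ltW eps0) ?(ltW d_gt0).
have -> : 4 / (eps * d ^+ 3) * (e ^+ 2 * enorm (E *m u))
    = eps^-1 * (2 * e / d * (2 / d ^+ 2 * (e * enorm (E *m u)))).
  by field; rewrite !gt_eqF.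
have inv x : enorm (invmx (1%:M + D) *m x) <= eps^-1 * enorm x.
  by apply: le_trans (enorm_opnorm _ _) _; apply: ler_wpM2r => //; apply: enorm_ge0.
apply: le_trans (inv _) _; apply: ler_wpM2l; first by rewrite invr_ge0 ltW.
apply: le_trans (enorm_Delta _) _; apply: ler_wpM2l.
  by rewrite !mulr_ge0 // invr_ge0 ltW.
exact: enorm_first_order.
Qed.

(** Since [|Delta| <= 1 - eps], [Id + Delta] shrinks no vector by more than the factor [eps]; it is
    thus invertible, with inverse of norm at most [1/eps]. *)
Lemma vvec_eq_vtilde : 0 < eps -> 2 * e / d <= 1 - eps ->
  vvec M U p w = vtilde M lam U p eps w.
Proof.
move=> eps0 small; rewrite /vtilde; suff -> : good M lam U p eps w by [].
have low x : eps * enorm x <= enorm ((1%:M + D) *m x).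
  rewrite mulmxDl mul1mx.
  have := enormB (x + D *m x) (D *m x); rewrite addrK => h1.
  have h2 := enorm_Delta x.
  by have := ler_wpM2r (enorm_ge0 x) small; lra.
have uD : 1%:M + D \in unitmx.
  rewrite -unitmx_tr -row_free_unit -kermx_eq0; apply/eqP/row_matrixP => i.
  rewrite row0; apply: trmx_inj; rewrite trmx0; apply: enorm_eq0.
  have : (1%:M + D) *m (row i (kermx (1%:M + D)^T))^T = 0.
    by apply: trmx_inj; rewrite trmx_mul trmxK -row_mul mulmx_ker row0 trmx0.
  move=> h; have := low (row i (kermx (1%:M + D)^T))^T; rewrite h enorm0 => h'.
  apply/eqP; rewrite eq_le enorm_ge0 andbT.
  by rewrite -(pmulr_rle0 _ eps0).
rewrite /good uD; apply: opnorm_le => x.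
have := low (invmx (1%:M + D) *m x); rewrite mulKVmx // => h.
by rewrite mulrC ler_pdivlMr // mulrC.
Qed.

End Outcome.
End Perturbation.

(** * Moments of the noise matrix *)

(** Convexity of the fourth power, with weights proportional to [c k * b k], at the normalized
    variables [e k / b k]; it follows from two uses of Cauchy-Schwarz. *)
Lemma mask_mean_Minkowski4 (R : realType) n (p : R) (I : finType) (c b : I -> R)
    (e : I -> omega n -> R) :
  0 < p -> p < 1 / 2 -> (forall k, 0 <= c k) -> (forall k, 0 < b k) ->
  (forall k, mask_mean p (fun w => e k w ^+ 4) <= b k ^+ 4) ->
  mask_mean p (fun w => (\sum_k c k * e k w) ^+ 4) <= (\sum_k c k * b k) ^+ 4.
Proof.
move=> p0 p2 c0 b0 eb; set B := \sum_k c k * b k.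
have B0 : 0 <= B by apply: sumr_ge0 => k _; rewrite mulr_ge0 // ltW.
have cb0 k : 0 <= c k * b k by rewrite mulr_ge0 // ltW.
have CS (a : I -> R) : (\sum_k c k * b k * a k) ^+ 2 <= (\sum_k c k * b k * a k ^+ 2) * B.
  have := sum_Cauchy_Schwarz _ _ xpredT (fun k => c k * b k) a (fun=> 1) cb0.
  under eq_bigr do rewrite mulr1.
  by under [X in _ <= _ * X]eq_bigr do rewrite expr1n mulr1.
apply: (@le_trans _ _ (mask_mean p (fun w => B ^+ 3 * \sum_k c k * b k * (e k w / b k) ^+ 4))).
  apply: (le_mask_mean p0 p2) => w.
  have -> : \sum_k c k * e k w = \sum_k c k * b k * (e k w / b k).
    by apply: eq_bigr => k _; field; rewrite gt_eqF.
  have h1 := CS (fun k => e k w / b k); have h2 := CS (fun k => (e k w / b k) ^+ 2).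
  set s1 := \sum_k c k * b k * (e k w / b k) in h1 *.
  set s2 := \sum_k c k * b k * (e k w / b k) ^+ 2 in h1 h2.
  have s4E : \sum_k c k * b k * ((e k w / b k) ^+ 2) ^+ 2 = \sum_k c k * b k * (e k w / b k) ^+ 4.
    by apply: eq_bigr => k _; rewrite -exprM.
  rewrite s4E in h2; set s4 := \sum_k _ in h2 *.
  have s20 : 0 <= s2 by apply: sumr_ge0 => k _; rewrite mulr_ge0 ?sqr_ge0.
  apply: (@le_trans _ _ ((s2 * B) ^+ 2)).
    by rewrite (exprM _ 2 2); apply: lerXn2r; rewrite ?nnegrE ?sqr_ge0 // mulr_ge0.
  rewrite exprMn; have := ler_wpM2r (sqr_ge0 B) h2; lra.
rewrite mask_meanZ (exprS B 3) mulrC; apply: ler_wpM2r; first exact: exprn_ge0.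
rewrite mask_mean_sum; apply: ler_sum => k _.
rewrite mask_meanZ -[leRHS]mulr1; apply: ler_wpM2l => //.
have -> : mask_mean p (fun w => (e k w / b k) ^+ 4) = b k ^- 4 * mask_mean p (fun w => e k w ^+ 4).
  by rewrite -mask_meanZ; apply: eq_mask_mean => w; rewrite expr_div_n mulrC.
by rewrite mulrC ler_pdivrMr ?exprn_gt0 // mul1r.
Qed.

Lemma infnorm_ge (R : realType) n (x : 'cV[R]_n) i : `|x i 0| <= infnorm x.
Proof. exact: (le_bigmax_cond 0 (fun i => `|x i 0|)). Qed.

Lemma infnorm_ge0 (R : realType) n (x : 'cV[R]_n) : 0 <= infnorm x.
Proof. exact: bigmax_ge_id. Qed.

Lemma sqr_infnorm_ge (R : realType) n (x : 'cV[R]_n) i : x i 0 ^+ 2 <= infnorm x ^+ 2.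
Proof.
rewrite -real_normK ?num_real //; apply: lerXn2r; rewrite ?nnegrE ?infnorm_ge0 //.
exact: infnorm_ge.
Qed.

(* card_supp counts a classical set, whose membership is decided by choice. *)
Lemma card_suppE (R : realType) n (x : 'cV[R]_n) : card_supp x = #|[set i | x i 0 != 0]%SET|.
Proof.
rewrite /card_supp; apply: eq_card => i; rewrite [RHS]inE.
by apply/idP/idP => [|h]; rewrite in_setE.
Qed.

Lemma enorm_le_infnorm (R : realType) n (x : 'cV[R]_n) :
  enorm x ^+ 2 <= (card_supp x)%:R * infnorm x ^+ 2.
Proof.
rewrite enorm_sqr dotE card_suppE; set T := [set i | _]%SET.
rewrite (bigID (mem T)) /= [X in _ + X]big1 ?addr0; last first.
  by move=> i; rewrite inE negbK => /eqP ->; rewrite mul0r.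
have -> : #|T|%:R * infnorm x ^+ 2 = \sum_(i in T) infnorm x ^+ 2.
  by rewrite sumr_const mulr_natl.
by apply: ler_sum => i _; rewrite -expr2; apply: sqr_infnorm_ge.
Qed.

Section Matrix.
(** [N k] stands for [n^alpha_k] and [N0] for [n^alpha_min]. *)
Variables (R : realType) (n : nat) (M : 'M[R]_n.+1) (lam : 'I_n.+1 -> R)
  (U : 'M[R]_n.+1) (p mu : R) (alpha : 'I_n.+1 -> R) (N : 'I_n.+1 -> R) (N0 : R).
Hypothesis UU : U^T *m U = 1%:M.
Hypothesis ME : M = \sum_i lam i *: (col i U *m (col i U)^T).
Hypothesis p_gt0 : 0 < p.
Hypothesis p_lt : p < 1 / 2.
Hypothesis N0_gt0 : 0 < N0.
Hypothesis N0_le : forall k, N0 <= N k.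
Hypothesis sum_le : \sum_i `|lam i| * N i * infnorm (col i U) ^+ 2 <= mu.
Hypothesis card_le : forall i, (card_supp (col i U))%:R <= N i.

Let N_gt0 k : 0 < N k.
Proof. exact: lt_le_trans N0_gt0 (N0_le k). Qed.

Let term_ge0 k : 0 <= `|lam k| * N k * infnorm (col k U) ^+ 2.
Proof. by rewrite !mulr_ge0 ?infnorm_ge0 // ltW. Qed.

Let UU' : U *m U^T = 1%:M.
Proof. exact: mulmx1C. Qed.

Let enorm_col k : enorm (col k U) = 1.
Proof.
rewrite colE enorm_orthogonal // /enorm (bigD1 k) //= mxE !eqxx expr1n big1 ?addr0 ?sqrtr1 //.
by move=> i /negbTE ik; rewrite mxE ik expr0n.
Qed.

(** A unit vector with at most [N k] nonzero entries has [N k * infnorm ^+ 2 >= 1]. *)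
Lemma eigenvalue_le k : `|lam k| <= mu.
Proof.
apply: le_trans sum_le; rewrite (bigD1 k) //=.
apply: (@le_trans _ _ (`|lam k| * N k * infnorm (col k U) ^+ 2)); last first.
  by rewrite lerDl; apply: sumr_ge0 => i _; exact: term_ge0.
rewrite -{1}[`|lam k|]mulr1 -mulrA; apply: ler_wpM2l => //.
rewrite -(expr1n _ 2) -(enorm_col k); apply: le_trans (enorm_le_infnorm _) _.
by apply: ler_wpM2r => //; exact: sqr_ge0.
Qed.

Lemma mu_ge0 : 0 <= mu.
Proof. exact: le_trans (normr_ge0 _) (eigenvalue_le ord0). Qed.

Lemma sum_infnorm_le : \sum_i `|lam i| * infnorm (col i U) ^+ 2 <= mu / N0.
Proof.
rewrite ler_pdivlMr //; apply: le_trans sum_le; rewrite mulr_suml; apply: ler_sum => k _.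
by rewrite mulrAC; apply: ler_wpM2r; [exact: sqr_ge0|apply: ler_wpM2l].
Qed.

Lemma Emat_entry w i j : Emat M p w i j = M i j * xi p w (edge i j).
Proof. by rewrite !mxE /xi /edge mulrBr mulr1. Qed.

(** The sum equals [sum_k lam_k^2 U_jk^2]; one factor [|lam_k|] is bounded by [mu], and the other is
    summed against the squared sup norm of [u_k]. *)
Lemma M_row_norm_le j : \sum_i M i j ^+ 2 <= mu ^+ 2 / N0.
Proof.
have -> : \sum_i M i j ^+ 2 = enorm (M *m delta_mx j 0) ^+ 2.
  rewrite enorm_sqr dotE; apply: eq_bigr => i _; rewrite -colE !mxE; exact: expr2.
rewrite ME sum_col_diag_mx -2!mulmxA enorm_orthogonal // enorm_sqr dotE.
have -> : mu ^+ 2 / N0 = mu * (mu / N0) by ring.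
apply: le_trans (ler_wpM2l mu_ge0 sum_infnorm_le); rewrite mulr_sumr; apply: ler_sum => k _.
rewrite -colE mul_diag_mx !mxE -expr2 exprMn -[lam k ^+ 2]real_normK ?num_real // expr2.
rewrite -mulrA; apply: ler_pM => //; first by rewrite mulr_ge0 ?sqr_ge0.
  exact: eigenvalue_le.
apply: ler_wpM2l => //; have := sqr_infnorm_ge (col k U) j; by rewrite mxE.
Qed.

Lemma mask_mean_xi e : upper e -> mask_mean p (fun w : omega n.+1 => xi p w e) = 0.
Proof.
move=> ue; have := mask_mean_prod (R := R) (p := p) (s := [:: e]).
rewrite /= ue => /(_ isT); under eq_mask_mean do rewrite big_seq1.
by rewrite mask_mom_seq1.
Qed.

Lemma mask_mean_xi2 e f : upper e -> upper f ->
  mask_mean p (fun w : omega n.+1 => xi p w e * xi p w f)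
  = if e == f then p^-1 - 1 else 0.
Proof.
move=> ue uf; have := mask_mean_prod (R := R) (p := p) (s := [:: e; f]).
rewrite /= ue uf => /(_ isT); under eq_mask_mean do rewrite big_cons big_seq1.
move=> ->; rewrite /mask_mom (bigD1 e) //= eqxx.
have [<-|ef] := eqVneq e f.
  rewrite centered_mom2 // big1 ?mulr1 // => x /negbTE xe.
  by rewrite eq_sym xe centered_mom0.
by rewrite centered_mom1 // mul0r.
Qed.

(** Entries of [Q - 1] in one row sit on distinct edges, so they are uncorrelated, with variance
    [1/p - 1]; the columns of [M] are then bounded by [M_row_norm_le]. *)
Lemma mask_mean_Emat_vec_le (x : 'cV[R]_n.+1) :
  mask_mean p (fun w => enorm (Emat M p w *m x) ^+ 2) <= mu ^+ 2 / (p * N0) * enorm x ^+ 2.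
Proof.
have row_var (a : 'I_n.+1 -> R) i :
    mask_mean p (fun w => (\sum_j a j * xi p w (edge i j)) ^+ 2) <= p^-1 * \sum_j a j ^+ 2.
  have -> : mask_mean p (fun w => (\sum_j a j * xi p w (edge i j)) ^+ 2)
      = \sum_j \sum_l a j * a l * mask_mean p (fun w => xi p w (edge i j) * xi p w (edge i l)).
    under eq_mask_mean do rewrite expr2 mulr_suml.
    rewrite mask_mean_sum; apply: eq_bigr => j _.
    under eq_mask_mean do rewrite mulr_sumr.
    rewrite mask_mean_sum; apply: eq_bigr => l _.
    by rewrite -mask_meanZ; apply: eq_mask_mean => w; ring.
  rewrite mulr_sumr; apply: ler_sum => j _.
  rewrite (bigD1 j) //= [X in _ + X]big1 ?addr0; last first.
    move=> l lj; rewrite mask_mean_xi2 ?edge_upper // ifF ?mulr0 //.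
    apply/negbTE; apply: contra lj => /eqP /edge_inj [[_ ->]//|[]]; by move=> -> ->.
  rewrite mask_mean_xi2 ?edge_upper // eqxx -expr2 mulrC; apply: ler_wpM2r; first exact: sqr_ge0.
  by rewrite gerBl.
have -> : mask_mean p (fun w => enorm (Emat M p w *m x) ^+ 2)
    = \sum_i mask_mean p (fun w => (\sum_j (M i j * x j 0) * xi p w (edge i j)) ^+ 2).
  rewrite -mask_mean_sum; apply: eq_mask_mean => w; rewrite enorm_sqr dotE.
  apply: eq_bigr => i _; rewrite -expr2 mxE; congr (_ ^+ 2); apply: eq_bigr => j _.
  by rewrite Emat_entry mulrAC.
apply: (@le_trans _ _ (\sum_i p^-1 * \sum_j (M i j * x j 0) ^+ 2)).
  by apply: ler_sum => i _; exact: row_var.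
rewrite -mulr_sumr exchange_big /= enorm_sqr dotE invfM mulrCA -mulrA.
apply: ler_wpM2l; first by rewrite invr_ge0 ltW.
rewrite mulr_sumr; apply: ler_sum => j _.
under eq_bigr do rewrite exprMn.
by rewrite -mulr_suml -expr2; apply: ler_wpM2r; [exact: sqr_ge0|exact: M_row_norm_le].
Qed.

Lemma expect_Emat_vec m (A : 'M[R]_(m, n.+1)) (x : 'cV[R]_n.+1) :
  expect p (fun w => A *m Emat M p w *m x) = 0.
Proof.
apply/matrixP => i k; rewrite summxE mxE.
have -> : \sum_w (prob p w *: (A *m Emat M p w *m x)) i k
   = mask_mean p (fun w => \sum_j \sum_l A i j * (M j l * x l k) * xi p w (edge j l)).
  apply: eq_bigr => w _; rewrite mxE -mulmxA; congr (_ * _); rewrite mxE.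
  apply: eq_bigr => j _; rewrite mxE mulr_sumr; apply: eq_bigr => l _.
  by rewrite Emat_entry; ring.
rewrite mask_mean_sum big1 // => j _; rewrite mask_mean_sum big1 // => l _.
by rewrite mask_meanZ mask_mean_xi ?edge_upper // mulr0.
Qed.

Section BlockNorm.
Variable e : 'I_n.+1 -> omega n.+1 -> R.
Hypothesis e_ge0 : forall k w, 0 <= e k w.
Hypothesis block_norm : forall k w (v : 'I_n.+1 -> R),
  \sum_(x in [set i | col k U i 0 != 0]%SET)
     (\sum_(y in [set i | col k U i 0 != 0]%SET) xi p w (edge x y) * v y) ^+ 2
  <= e k w ^+ 2 * \sum_(x in [set i | col k U i 0 != 0]%SET) v x ^+ 2.

(* E = sum_k lam_k D_k X D_k with D_k the diagonal matrix of u_k, and D_k only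
   sees the block of X indexed by the support of u_k. *)
Lemma Emat_norm_le w x :
  enorm (Emat M p w *m x) <= (\sum_k `|lam k| * infnorm (col k U) ^+ 2 * e k w) * enorm x.
Proof.
pose y k : 'cV[R]_n.+1 := \col_i (U i k * \sum_j xi p w (edge i j) * (U j k * x j 0)).
have -> : Emat M p w *m x = \sum_k lam k *: y k.
  apply/matrixP => i j; rewrite ord1 mxE summxE.
  under [RHS]eq_bigr do rewrite !mxE !mulr_sumr.
  rewrite exchange_big /=; apply: eq_bigr => l _.
  rewrite Emat_entry ME summxE !mulr_suml; apply: eq_bigr => k _.
  by rewrite !mxE big_ord1 !mxE; ring.
apply: le_trans (enorm_sum _ _ _) _; rewrite mulr_suml; apply: ler_sum => k _.
set b := infnorm (col k U) ^+ 2; have b0 : 0 <= b by exact: sqr_ge0.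
have Ub i : U i k ^+ 2 <= b by have := sqr_infnorm_ge (col k U) i; rewrite mxE.
clearbody b.
rewrite enormZ -!mulrA; apply: ler_wpM2l => //.
apply: enorm_le; first by rewrite !mulr_ge0 ?enorm_ge0.
rewrite !exprMn dotE; set T := [set i | col k U i 0 != 0]%SET.
have outT i : i \notin T -> U i k = 0 by rewrite inE mxE negbK => /eqP.
have -> : \sum_i y k i 0 * y k i 0
   = \sum_(i in T) U i k ^+ 2 * (\sum_(j in T) xi p w (edge i j) * (U j k * x j 0)) ^+ 2.
  rewrite (bigID (mem T)) /= [X in _ + X]big1 ?addr0; last first.
    by move=> i /outT iT; rewrite !mxE iT !mul0r.
  apply: eq_bigr => i iT; rewrite !mxE -expr2 exprMn; congr (_ * _ ^+ 2).
  rewrite (bigID (mem T)) /= [X in _ + X]big1 ?addr0 //.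
  by move=> j /outT jT; rewrite jT mul0r mulr0.
apply: (@le_trans _ _ (b * \sum_(i in T) (\sum_(j in T) xi p w (edge i j) * (U j k * x j 0)) ^+ 2)).
  by rewrite mulr_sumr; apply: ler_sum => i _; apply: ler_wpM2r; [exact: sqr_ge0|].
rewrite [b ^+ 2]expr2 -[leRHS]mulrA; apply: ler_wpM2l => //.
apply: le_trans (block_norm _ _ _) _; rewrite [leRHS]mulrCA; apply: ler_wpM2l; first exact: sqr_ge0.
rewrite enorm_sqr dotE mulr_sumr [leRHS](bigID (mem T)) /= -[leLHS]addr0; apply: lerD.
  by apply: ler_sum => i _; rewrite exprMn -expr2; apply: ler_wpM2r; [exact: sqr_ge0|].
by apply: sumr_ge0 => i _; rewrite mulr_ge0 // -expr2 sqr_ge0.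
Qed.

(** From [N0 <= N k] follows [sqrt (N_k / p) <= N_k / sqrt (p N0)], which turns the weighted sum of
    block norms into the sum bounded by [mu]. *)
Lemma Emat_norm_moment_le a : 0 < a ->
  (forall k, mask_mean p (fun w => e k w ^+ 4) <= a ^+ 4 * (N k / p) ^+ 2) ->
  mask_mean p (fun w => (\sum_k `|lam k| * infnorm (col k U) ^+ 2 * e k w) ^+ 4)
  <= (a * (mu / Num.sqrt (p * N0))) ^+ 4.
Proof.
move=> a0 ea; pose b k := a * Num.sqrt (N k / p).
have b0 k : 0 < b k by rewrite mulr_gt0 // sqrtr_gt0 divr_gt0.
have c0 k : 0 <= `|lam k| * infnorm (col k U) ^+ 2 by rewrite mulr_ge0 ?sqr_ge0.
have eb k : mask_mean p (fun w => e k w ^+ 4) <= b k ^+ 4.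
  rewrite exprMn (exprM (Num.sqrt _) 2 2) sqr_sqrtr // divr_ge0 // ltW //.
apply: le_trans (mask_mean_Minkowski4 p_gt0 p_lt c0 b0 eb) _.
have s0 : 0 < Num.sqrt (p * N0) by rewrite sqrtr_gt0 mulr_gt0.
have le : \sum_k `|lam k| * infnorm (col k U) ^+ 2 * b k <= a * (mu / Num.sqrt (p * N0)).
  rewrite mulrA ler_pdivlMr // mulr_suml.
  apply: le_trans (ler_wpM2l (ltW a0) sum_le); rewrite mulr_sumr; apply: ler_sum => k _.
  have h : Num.sqrt (N k / p) * Num.sqrt (p * N0) <= N k.
    rewrite -sqrtrM ?divr_ge0 ?(ltW (N_gt0 k)) ?(ltW p_gt0) //.
    have -> : N k / p * (p * N0) = N k * N0 by field; rewrite gt_eqF.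
    rewrite -[leRHS]ger0_norm ?(ltW (N_gt0 k)) // -sqrtr_sqr; apply: ler_wsqrtr.
    by rewrite expr2; apply: ler_wpM2l => //; exact: ltW.
  have := ler_wpM2l (mulr_ge0 (ltW a0) (c0 k)) h; rewrite /b; lra.
apply: lerXn2r; rewrite ?nnegrE //.
  by apply: sumr_ge0 => k _; rewrite mulr_ge0 // ltW.
by apply: le_trans le; apply: sumr_ge0 => k _; rewrite mulr_ge0 // ltW.
Qed.

End BlockNorm.
End Matrix.

(** * Bias and asymptotics *)

(** Carries the growth condition from [n^alpha_min] to the larger block sizes [n^alpha_k]. If
    [y = x z^4], then [ln y <= ln x + 4 (z - 1) <= 4 z ln x], and [256 = 4^4]. *)
Lemma ln_pow4_ratio_le (R : realType) (x y : R) :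
  0 < x -> x <= y -> 1 <= ln x -> ln y ^+ 4 / y <= 256 * (ln x ^+ 4 / x).
Proof.
move=> x0 xy lx; have y0 : 0 < y by exact: lt_le_trans xy.
set r := y / x; have r0 : 0 < r by rewrite divr_gt0.
have r1 : 1 <= r by rewrite ler_pdivlMr // mul1r.
set z := r `^ (4^-1); have z0 : 0 < z by exact: powR_gt0.
have z4 : z ^+ 4 = r by rewrite -powR_mulrn ?(ltW z0) // -powRrM mulVf // powRr1 // ltW.
have z1 : 1 <= z.
  by rewrite -(@ler_pXn2r _ 4) ?nnegrE ?(ltW z0) // expr1n z4.
have lz : ln z <= z - 1.
  have -> : ln z = ln (1 + (z - 1)) by congr ln; ring.
  by apply: le_ln1Dx; lra.
have lyE : ln y = ln x + 4 * ln z.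
  have -> : y = x * z ^+ 4 by rewrite z4 /r; field; rewrite gt_eqF.
  by rewrite lnM ?posrE ?exprn_gt0 // lnXn // mulr_natl.
have lz0 : 0 <= ln z by exact: ln_ge0.
have ly : ln y <= 4 * (ln x * z) by rewrite lyE; nra.
have ly0 : 0 <= ln y by rewrite lyE; lra.
rewrite ler_pdivrMr //.
have -> : 256 * (ln x ^+ 4 / x) * y = (4 * (ln x * z)) ^+ 4.
  by rewrite !exprMn z4 /r; field; rewrite gt_eqF.
by apply: lerXn2r; rewrite ?nnegrE ?(le_trans ly0).
Qed.

Lemma dimn_gt1 (R : realType) n : 1 < dimn n :> R.
Proof. by rewrite /dimn ltr1n. Qed.

Lemma amin_le (R : realType) n (a : 'I_n.+1 -> R) i : amin a <= a i.
Proof. exact: bigmin_le. Qed.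

Lemma Emat_norm_moment (R : realType) (eta : R) : 0 < eta ->
  exists2 c : R, 0 < c & forall n (M : 'M[R]_n.+2) (lam : 'I_n.+2 -> R) (U : 'M[R]_n.+2)
    (p mu : R) (alpha : 'I_n.+2 -> R),
  U^T *m U = 1%:M ->
  M = \sum_i lam i *: (col i U *m (col i U)^T) ->
  0 < p -> p < 1 / 2 ->
  \sum_i `|lam i| * (dimn n `^ alpha i) * infnorm (col i U) ^+ 2 <= mu ->
  (forall i, (card_supp (col i U))%:R <= dimn n `^ alpha i) ->
  1 <= amin alpha * ln (dimn n) -> c^-1 <= amin alpha * ln (dimn n) ->
  (amin alpha * ln (dimn n)) ^+ 4 / (p * dimn n `^ amin alpha) <= c ->
  exists2 e : omega n.+2 -> R, forall w, 0 <= e w &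
    (forall w x, enorm (Emat M p w *m x) <= e w * enorm x) /\
    mask_mean p (fun w => e w ^+ 4)
      <= ((2 + eta) * (mu / Num.sqrt (p * dimn n `^ amin alpha))) ^+ 4.
Proof.
move=> eta0; have [c c0 block] := mask_norm_moment _ _ eta0.
(* Compensates the factor [256] lost between [N0] and [N k]. *)
exists (c / 256); first by rewrite divr_gt0.
move=> n M lam U p mu alpha UU ME p0 p2 sum_le card_le x1 xc xp.
have d1 := dimn_gt1 R n.
have d0 : 0 < dimn n :> R by exact: lt_trans d1.
pose N i : R := dimn n `^ alpha i; pose N0 : R := dimn n `^ amin alpha.
have N00 : 0 < N0 by exact: powR_gt0.
have N0N i : N0 <= N i by apply: ler_powR; [exact: ltW|exact: amin_le].
have lnN0 : ln N0 = amin alpha * ln (dimn n) by exact: ln_powR.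
rewrite -lnN0 -/N0 in x1 xc xp *.
have /choice[e He] : forall k, exists f : omega n.+2 -> R,
   (forall w, 0 <= f w) /\
   (forall w (v : 'I_n.+2 -> R),
         \sum_(x in [set i | col k U i 0 != 0]%SET)
           (\sum_(y in [set i | col k U i 0 != 0]%SET) xi p w (edge x y) * v y) ^+ 2
         <= f w ^+ 2 * \sum_(x in [set i | col k U i 0 != 0]%SET) v x ^+ 2) /\
      mask_mean p (fun w => f w ^+ 4) <= (2 + eta) ^+ 4 * (N k / p) ^+ 2.
  move=> k; have Nk0 : 0 < N k by exact: lt_le_trans (N0N k).
  have lnNk : ln N0 <= ln (N k) by rewrite ler_ln ?posrE.
  have [||||||f f0 [f1 f2]] := block _ p (N k) [set i | col k U i 0 != 0]%SET => //.
  - by have := card_le k; rewrite card_suppE.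
  - apply: le_trans lnNk; apply: le_trans xc; rewrite invf_div ler_pdivlMr //.
    by rewrite mulVf ?gt_eqF // ler1n.
  - have := ln_pow4_ratio_le N00 (N0N k) x1.
    rewrite ler_pdivrMr // => /le_trans; apply.
    have -> : 256 * (ln N0 ^+ 4 / N0) * N k = 256 * p * N k * (ln N0 ^+ 4 / (p * N0)).
      by field; rewrite !gt_eqF.
    have -> : c * (p * N k) = 256 * p * N k * (c / 256) by field.
    by apply: ler_wpM2l => //; rewrite !mulr_ge0 // ltW.
  - by exists f.
have e0 k w : 0 <= e k w by have [h _] := He k; exact: h.
have e1 k := (He k).2.1; have e2 k := (He k).2.2.
have a0 : 0 < 2 + eta by lra.
exists (fun w => \sum_k `|lam k| * infnorm (col k U) ^+ 2 * e k w).
  by move=> w; apply: sumr_ge0 => k _; rewrite mulr_ge0 // mulr_ge0 // sqr_ge0.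
split; first by move=> w x; exact: (Emat_norm_le ME e0 e1).
exact: (Emat_norm_moment_le p0 p2 N00 N0N sum_le a0 e2).
Qed.

Section Bias.
Variables (R : realType) (n : nat) (M : 'M[R]_n.+1) (lam : 'I_n.+1 -> R)
  (U : 'M[R]_n.+1) (p eps d a s : R) (e : omega n.+1 -> R).
Hypothesis UU : U^T *m U = 1%:M.
Hypothesis ME : M = \sum_i lam i *: (col i U *m (col i U)^T).
Hypothesis d_gt0 : 0 < d.
Hypothesis gap : forall j, j != ord0 -> d <= lam ord0 - lam j.
Hypothesis p_gt0 : 0 < p.
Hypothesis p_lt : p < 1 / 2.
Hypothesis eps_gt0 : 0 < eps.
Hypothesis a_ge0 : 0 <= a.
Hypothesis s_ge0 : 0 <= s.
Hypothesis e_ge0 : forall w, 0 <= e w.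
Hypothesis normE : forall w x, enorm (Emat M p w *m x) <= e w * enorm x.
Hypothesis moment4 : mask_mean p (fun w => e w ^+ 4) <= (a * s) ^+ 4.

Let mean2 : mask_mean p (fun w => e w ^+ 2) <= (a * s) ^+ 2.
Proof.
have h := mask_mean_Cauchy_Schwarz p_gt0 p_lt (fun w => e w ^+ 2) (fun=> 1).
have {}h : mask_mean p (fun w => e w ^+ 2) ^+ 2 <= ((a * s) ^+ 2) ^+ 2.
  move: h; under eq_mask_mean do rewrite mulr1.
  under [X in _ <= X * _]eq_mask_mean do rewrite -exprM.
  by rewrite expr1n mask_mean_cst mulr1 -exprM => /le_trans; apply.
move: h; rewrite ler_pXn2r ?nnegrE ?sqr_ge0 //.
by apply: (mask_mean_ge0 p_gt0 p_lt) => w; rewrite sqr_ge0.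
Qed.

Lemma enorm_expect_le m (f : omega n.+1 -> 'cV[R]_m) :
  enorm (expect p f) <= mask_mean p (fun w => enorm (f w)).
Proof.
apply: le_trans (enorm_sum _ _ _) _; apply: ler_sum => w _.
by rewrite enormZ ger0_norm // (prob_ge0 p_gt0 p_lt).
Qed.

Lemma enorm_expect_bias_le :
  mask_mean p (fun w => enorm (Emat M p w *m uvec U) ^+ 2) <= s ^+ 2 ->
  enorm (expect p (fun w => uvec U - vtilde M lam U p eps w))
  <= 2 * a / d ^+ 2 * s ^+ 2 + 4 * a ^+ 2 / (eps * d ^+ 3) * s ^+ 3.
Proof.
move=> meanEu; set b := fun w => enorm (Emat M p w *m uvec U).
have b0 w : 0 <= b w by exact: enorm_ge0.
have m1 : mask_mean p (fun w => e w * b w) <= a * s ^+ 2.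
  have h := mask_mean_Cauchy_Schwarz p_gt0 p_lt e b.
  have {}h : mask_mean p (fun w => e w * b w) ^+ 2 <= (a * s ^+ 2) ^+ 2.
    apply: le_trans h _; have -> : (a * s ^+ 2) ^+ 2 = (a * s) ^+ 2 * s ^+ 2 by ring.
    by apply: ler_pM => //; apply: (mask_mean_ge0 p_gt0 p_lt) => w; rewrite sqr_ge0.
  move: h; rewrite ler_pXn2r ?nnegrE ?mulr_ge0 ?sqr_ge0 //.
  by apply: (mask_mean_ge0 p_gt0 p_lt) => w; rewrite mulr_ge0.
have m2 : mask_mean p (fun w => e w ^+ 2 * b w) <= a ^+ 2 * s ^+ 3.
  have h := mask_mean_Cauchy_Schwarz p_gt0 p_lt (fun w => e w ^+ 2) b.
  have {}h : mask_mean p (fun w => e w ^+ 2 * b w) ^+ 2 <= (a ^+ 2 * s ^+ 3) ^+ 2.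
    apply: le_trans h _; have -> : (a ^+ 2 * s ^+ 3) ^+ 2 = (a * s) ^+ 4 * s ^+ 2 by ring.
    under [X in X * _]eq_mask_mean do rewrite -exprM.
    apply: ler_pM => //; apply: (mask_mean_ge0 p_gt0 p_lt) => w; rewrite ?sqr_ge0 //.
    exact: exprn_ge0.
  move: h; rewrite ler_pXn2r ?nnegrE //; last first.
    by apply: mulr_ge0; apply: exprn_ge0.
  by apply: (mask_mean_ge0 p_gt0 p_lt) => w; rewrite mulr_ge0 ?sqr_ge0.
pose D w := Delta M lam U p w.
pose z w := Rmat lam U *m Emat M p w *m uvec U.
pose g w := if good M lam U p eps w then invmx (1%:M + D w) *m (D w *m (D w *m z w)) else 0.
have -> : expect p (fun w => uvec U - vtilde M lam U p eps w)
   = expect p z + expect p (fun w => g w - D w *m z w).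
  rewrite /expect -big_split; apply: eq_bigr => w _ /=.
  rewrite -scalerDr; congr (_ *: _).
  by rewrite (uvec_sub_vtilde _ _ UU ME d_gt0 gap) addrAC addrA.
rewrite expect_Emat_vec // add0r.
apply: le_trans (enorm_expect_le _) _.
apply: (@le_trans _ _ (mask_mean p (fun w =>
   2 / d ^+ 2 * (e w * b w) + 4 / (eps * d ^+ 3) * (e w ^+ 2 * b w)))).
  apply: (le_mask_mean p_gt0 p_lt) => w; apply: le_trans (enormB _ _) _; rewrite addrC.
  apply: lerD.
    by apply: (enorm_first_order UU ME d_gt0 gap) => x; exact: normE.
  by apply: (enorm_second_order UU ME d_gt0 gap) => // x; exact: normE.
rewrite mask_meanD !mask_meanZ.
have c1 : 0 <= 2 / d ^+ 2 by rewrite divr_ge0 // sqr_ge0.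
have c2 : 0 <= 4 / (eps * d ^+ 3).
  by rewrite divr_ge0 // mulr_ge0 ?exprn_ge0 ?(ltW eps_gt0) ?(ltW d_gt0).
have := lerD (ler_wpM2l c1 m1) (ler_wpM2l c2 m2).
move/le_trans; apply; rewrite le_eqVlt; apply/orP; left; apply/eqP.
by field; rewrite !gt_eqF.
Qed.

(** Markov's inequality for [e ^+ 2]: the two vectors can differ only where [2 e / d > 1 - eps]. *)
Lemma Pr_vvec_eq_vtilde_ge : eps < 1 ->
  1 - 4 / (1 - eps) ^+ 2 * (a * s / d) ^+ 2
  <= Pr p (fun w => vvec M U p w == vtilde M lam U p eps w) <= 1.
Proof.
move=> eps1.
have PrE (P : omega n.+1 -> bool) : Pr p P = mask_mean p (fun w => (P w)%:R).
  by rewrite /Pr big_mkcond; apply: eq_bigr => w _; case: (P w); rewrite ?mulr1 ?mulr0.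
rewrite PrE; apply/andP; split; last first.
  rewrite -[leRHS](mask_mean_cst _ n.+1 p); apply: (le_mask_mean p_gt0 p_lt) => w.
  by case: eqP.
have e10 : 0 < 1 - eps by lra.
set k := 4 / ((1 - eps) ^+ 2 * d ^+ 2).
have k0 : 0 <= k by rewrite divr_ge0 // mulr_ge0 ?sqr_ge0.
have kE : 4 / (1 - eps) ^+ 2 * (a * s / d) ^+ 2 = k * (a * s) ^+ 2.
  by rewrite /k; field; rewrite !gt_eqF.
apply: (@le_trans _ _ (mask_mean p (fun w => 1 + (- k) * e w ^+ 2))).
  rewrite mask_meanD mask_mean_cst mask_meanZ lerD2l kE -mulNr ler_wnM2l // oppr_le0 //.
apply: (le_mask_mean p_gt0 p_lt) => w.
case: eqP => [_|/eqP neq] /=; first by rewrite mulr1n; have := mulr_ge0 k0 (sqr_ge0 (e w)); lra.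
rewrite mulr0n; have : ~~ (2 * e w / d <= 1 - eps).
  apply: contra neq => small; apply/eqP.
  by apply: (vvec_eq_vtilde UU ME d_gt0 gap _ eps_gt0 small) => x; exact: normE.
rewrite -ltNge ltr_pdivlMr // => big.
have {}big : ((1 - eps) * d) ^+ 2 <= (2 * e w) ^+ 2.
  apply: lerXn2r; rewrite ?nnegrE ?mulr_ge0 ?(ltW e10) ?(ltW d_gt0) //; exact: ltW.
have m0 : 0 < (1 - eps) ^+ 2 * d ^+ 2 by rewrite mulr_gt0 ?exprn_gt0.
have : 1 <= k * e w ^+ 2.
  rewrite /k mulrAC ler_pdivlMr // mul1r -exprMn; apply: le_trans big _.
  by rewrite exprMn; have -> : 2 ^+ 2 = 4 :> R by ring.
by lra.
Qed.

End Bias.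

(** With [l = ln (dimn n)], the product exceeds [l^((delta + 1) / 4) >= l^(1/4)], which is at least
    [|K|] once [l >= 1 + |K|^4]. *)
Lemma amin_ln_dimn_diverges (R : realType) (x : nat -> R) :
  (exists2 delta : R, 0 < delta & \forall n \near \oo, ln (dimn n) `^ ((delta - 3) / 4) < x n) ->
  forall K : R, \forall n \near \oo, K <= x n * ln (dimn n).
Proof.
move=> [delta delta0 Hx] K.
have := nbhs_infty_ger (expR (1 + `|K| ^+ 4)); apply: filterS2 Hx => n xn Kn.
have d0 : 0 < dimn n :> R by exact: lt_trans (dimn_gt1 R n).
have l1 : 1 + `|K| ^+ 4 <= ln (dimn n).
  rewrite -[leLHS](expRK (R := R)) ler_ln ?posrE ?expR_gt0 //; apply: le_trans Kn _.
  by rewrite /dimn ler_nat; lia.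
set l := ln (dimn n) in l1 xn *.
have K40 : 0 <= `|K| ^+ 4 by exact: exprn_ge0.
have l0 : 0 < l by lra.
apply: (@le_trans _ _ (l `^ ((delta - 3) / 4) * l)); last by rewrite ler_wpM2r // ltW.
have -> : l `^ ((delta - 3) / 4) * l = l `^ ((delta + 1) / 4).
  have -> : (delta + 1) / 4 = (delta - 3) / 4 + 1 by field.
  rewrite [RHS]powRD; last by rewrite (gt_eqF l0) implybT.
  by rewrite powRr1 // ltW.
apply: (@le_trans _ _ (l `^ (4^-1))); last first.
  by apply: ler_powR; lra.
apply: le_trans (ler_norm K) _.
rewrite -(@ler_pXn2r _ 4) ?nnegrE ?powR_ge0 // -[leRHS]powR_mulrn ?powR_ge0 //.
rewrite -powRrM mulVf // powRr1 ?(ltW l0) //.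
by lra.
Qed.

Lemma spectral_gap (R : realType) n (lam : 'I_n.+2 -> R) :
  (forall i j : 'I_n.+2, (i < j)%N -> lam j < lam i) ->
  0 < lam ord0 - lam (inord 1) /\
  forall j, j != ord0 -> lam ord0 - lam (inord 1) <= lam ord0 - lam j.
Proof.
move=> dec; have i1 : (inord 1 : 'I_n.+2) = 1%N :> nat by rewrite inordK.
split; first by rewrite subr_gt0; apply: dec; rewrite i1.
move=> j j0; rewrite lerD2l lerN2.
have [->//|j1] := eqVneq j (inord 1); apply/ltW/dec; rewrite i1.
have : (j : nat) != 0%N by apply: contra j0 => /eqP h; apply/eqP/val_inj.
have : (j : nat) != 1%N by apply: contra j1 => /eqP h; apply/eqP/val_inj; rewrite /= i1.
lia.
Qed.

Theorem mainTheorem7 (R : realType)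
  (M : forall n, 'M[R]_n.+2) (lam : forall n, 'I_n.+2 -> R)
  (U : forall n, 'M[R]_n.+2) (p : nat -> R) (alpha : forall n, 'I_n.+2 -> R)
  (mu : R) :
  (forall n, (U n)^T *m U n = 1%:M) ->
  (forall n, M n = \sum_i lam n i *: (col i (U n) *m (col i (U n))^T)) ->
  (forall n (i j : 'I_n.+2), (i < j)%N -> lam n j < lam n i) ->
  (forall n, 0 < p n < 1) ->
  (forall n i, 0 <= alpha n i <= 1) ->
  (forall n, \sum_i `|lam n i| * (dimn n `^ alpha n i) * infnorm (col i (U n)) ^+ 2
               <= mu) ->
  (forall n i, (card_supp (col i (U n)))%:R <= dimn n `^ alpha n i) ->
  (forall n, p n < 1 / 2) ->
  (exists2 delta : R, 0 < delta &
     \forall n \near \oo, ln (dimn n) `^ ((delta - 3) / 4) < amin (alpha n)) ->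
  ((fun n => (amin (alpha n) * ln (dimn n)) ^+ 4
               / (p n * dimn n `^ amin (alpha n))) @ \oo --> (0 : R)) ->
  (forall eps eta : R, 0 < eps -> 0 < eta ->
     \forall n \near \oo,
       enorm (expect (p n) (fun w => col ord0 (U n)
                                      - vtilde (M n) (lam n) (U n) (p n) eps w))
       <= (8 + eta) / (lam n ord0 - lam n (inord 1)) ^+ 2
            * (mu ^+ 2 / (p n * dimn n `^ amin (alpha n)))
          + (16 + eta) / (eps * (lam n ord0 - lam n (inord 1)) ^+ 3)
            * (mu ^+ 2 / (p n * dimn n `^ amin (alpha n))) `^ (3 / 2))
  /\
  (((fun n => (lam n ord0 - lam n (inord 1))^-1
                * (mu / Num.sqrt (p n * dimn n `^ amin (alpha n)))) @ \oo --> (0 : R)) ->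
   forall eps : R, 0 < eps < 1 ->
     (fun n => Pr (p n) (fun w => vvec (M n) (U n) (p n) w
                                  == vtilde (M n) (lam n) (U n) (p n) eps w))
       @ \oo --> (1 : R)).
Proof.
move=> UU ME dec p01 a01 sum_le card_le p2 amin_log ratio0.
have p0 n : 0 < p n by have /andP[] := p01 n.
pose N0 n : R := dimn n `^ amin (alpha n).
pose s n : R := mu / Num.sqrt (p n * N0 n).
pose d n : R := lam n ord0 - lam n (inord 1).
have N0_gt0 n : 0 < N0 n by apply: powR_gt0; exact: lt_trans (dimn_gt1 R n).
have N0_le n i : N0 n <= dimn n `^ alpha n i.
  by apply: ler_powR; [exact/ltW/dimn_gt1|exact: amin_le].
have pN0 n : 0 < p n * N0 n by rewrite mulr_gt0.
have d_gt0 n : 0 < d n := (spectral_gap (dec n)).1.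
have gap n := (spectral_gap (dec n)).2.
have mu0 : 0 <= mu := mu_ge0 (UU 0%N) (N0_gt0 0%N) (N0_le 0%N) (sum_le 0%N) (card_le 0%N).
have s_ge0 n : 0 <= s n by rewrite divr_ge0 // sqrtr_ge0.
have s2 n : s n ^+ 2 = mu ^+ 2 / (p n * N0 n) by rewrite expr_div_n sqr_sqrtr // ltW.
have s3 n : (mu ^+ 2 / (p n * N0 n)) `^ (3 / 2) = s n ^+ 3.
  rewrite -s2 -!powR_mulrn // -powRrM; congr (_ `^ _).
  by rewrite mulrC divfK.
have eventually_moment eta : 0 < eta -> \forall n \near \oo,
    exists2 e : omega n.+2 -> R, forall w, 0 <= e w &
    (forall w x, enorm (Emat (M n) (p n) w *m x) <= e w * enorm x) /\
    mask_mean (p n) (fun w => e w ^+ 4) <= ((2 + eta) * s n) ^+ 4.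
  move=> eta0; have [c c0 H] := Emat_norm_moment eta0.
  have ev1 := amin_ln_dimn_diverges amin_log 1.
  have ev2 := amin_ln_dimn_diverges amin_log c^-1.
  have ev3 : \forall n \near \oo, `|(amin (alpha n) * ln (dimn n)) ^+ 4
      / (p n * dimn n `^ amin (alpha n))| <= c by exact: cvgr0_norm_le.
  apply: filterS3 ev1 ev2 ev3 => n h1 h2 h3.
  by apply: (H n (M n) (lam n) (U n) (p n) mu (alpha n)) => //; exact: le_trans (ler_norm _) h3.
split=> [eps eta eps0 eta0|ratio eps /andP[eps0 eps1]].
  (* For [eta' <= 1], [4 (2 + eta')^2 <= 16 + 20 eta']. The first-order constant [2 (2 + eta')] is
     well below [8]. *)
  pose eta' := Num.min 1 (eta / 20).
  have eta'0 : 0 < eta' by rewrite lt_min ltr01 divr_gt0.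
  have eta'1 : eta' <= 1 by rewrite ge_min lexx.
  have eta'2 : eta' <= eta / 20 by rewrite ge_min lexx orbT.
  have ev := eventually_moment _ eta'0; apply: filterS ev => n [e e0 [normE moment4]].
  have a0 : 0 <= 2 + eta' by lra.
  have meanEu : mask_mean (p n) (fun w => enorm (Emat (M n) (p n) w *m uvec (U n)) ^+ 2) <= s n ^+ 2.
    have := mask_mean_Emat_vec_le (UU n) (ME n) (p0 n) (N0_gt0 n) (N0_le n)
      (sum_le n) (card_le n) (uvec (U n)).
    by rewrite enorm_uvec // expr1n mulr1 s2.
  have := enorm_expect_bias_le (UU n) (ME n) (d_gt0 n) (gap n) (p0 n) (p2 n) eps0 a0
    (s_ge0 n) e0 normE moment4 meanEu.
  move=> /le_trans; apply; rewrite -/(N0 n) s3 -s2 -/(d n).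
  apply: lerD.
    apply: ler_wpM2r; first exact: sqr_ge0.
    apply: ler_wpM2r; first by rewrite invr_ge0 sqr_ge0.
    by lra.
  apply: ler_wpM2r; first exact: exprn_ge0.
  apply: ler_wpM2r; first by rewrite invr_ge0 mulr_ge0 ?exprn_ge0 ?(ltW eps0) ?(ltW (d_gt0 n)).
  by nra.
apply/cvgrPdist_le => r r0.
(* The moment bound is used with [a = 2 + 1], so [36 = 4 * 3^2]. Below, the minimum with [1] makes
   the square of the ratio at most the ratio itself. *)
pose k := 36 / (1 - eps) ^+ 2.
have e10 : 0 < 1 - eps by lra.
have k0 : 0 < k by rewrite divr_gt0 ?exprn_gt0.
have t0 : 0 < Num.min 1 (r / k) by rewrite lt_min ltr01 divr_gt0.
have ev1 := eventually_moment _ ltr01.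
have ev2 : \forall n \near \oo, `|(d n)^-1 * s n| <= Num.min 1 (r / k) by exact: cvgr0_norm_le.
apply: filterS2 ev1 ev2 => n [e e0 [normE moment4]] small.
have /andP[Pr_ge Pr_le] := Pr_vvec_eq_vtilde_ge (UU n) (ME n) (d_gt0 n) (gap n) (p0 n) (p2 n) eps0
  e0 normE moment4 eps1.
set P := Pr _ _ in Pr_ge Pr_le *.
rewrite ger0_norm ?subr_ge0 // lerBlDl -lerBlDr; apply: le_trans Pr_ge.
rewrite lerD2l lerN2 -/(d n).
have -> : (2 + 1) * s n / d n = 3 * ((d n)^-1 * s n) by field; rewrite gt_eqF.
have : `|(d n)^-1 * s n| ^+ 2 <= r / k.
  move: small; rewrite le_min => /andP[h1 h2]; apply: le_trans h2.
  by rewrite expr2 ler_piMr.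
rewrite real_normK ?num_real // ler_pdivlMr // => h.
have -> : 4 / (1 - eps) ^+ 2 * (3 * ((d n)^-1 * s n)) ^+ 2 = ((d n)^-1 * s n) ^+ 2 * k.
  by rewrite /k; set x := _ * s n; field; rewrite gt_eqF.
exact: h.
Qed.
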